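(* Let $p\ge 2$ be a constant and $0<\varepsilon<1$. In the coordinator model where site $i\in[k]$ holds $v^{(i)}\in\mathbb Z_{\ge0}^n$ (entries bounded by $\mathrm{poly}(n)$), $v=\sum_i v^{(i)}$ and $F_p(v)=\sum_{j=1}^n v_j^p$: (1) there exists a 2-round protocol that, with constant probability, outputs $\hat F$ with $|\hat F-F_p(v)|\le\varepsilon F_p(v)$, using $O\!\left(\frac{k^{p-1}}{\varepsilon^2}\mathrm{polylog}(n)\right)$ bits of communication; (2) there exists a 1-round protocol with the same guarantee using $O\!\left(\frac{k^{p-1}}{\varepsilon^{p+2}}\mathrm{polylog}(n)\right)$ bits of communication.
   Context: Coordinator model: $k$ sites and a coordinator; site $i$ knows only $v^{(i)}$; communication cost is the total number of bits exchanged between the coordinator and all sites; a round is one exchange of messages between sites and coordinator. *)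

(* Defs.v *)
From HB Require Import structures.
From mathcomp Require Import all_boot all_order all_algebra.
From mathcomp Require Import all_classical all_reals all_analysis.

Set Implicit Arguments.
Unset Strict Implicit.
Unset Printing Implicit Defensive.

Import Order.TTheory GRing.Theory Num.Theory.
Local Open Scope ring_scope.

Notation bits := (seq bool).

(* Randomised protocols in the coordinator model with k sites, each holding an
   input of type X, and an input-free coordinator.  All parties see a common
   random string, drawn from a finite probability space and not charged for.
   In every round each site sends a string to the coordinator, which then
   answers each site; sites communicate with no one else.
   - [site_msg w i x ds]: what site i sends when the coins are w, its input is x
     and the strings received from the coordinator in the earlier rounds are ds,
     in chronological order (so [size ds] is the index of the round).
   - [coord_msg w us]: what the coordinator answers after the rounds whose
     uplink messages are us (current round included, chronological order).
   - [output w us]: the result, computed by the coordinator.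
   The two prefix-freeness conditions make every message self-delimiting, so
   that neither lengths nor empty messages carry uncharged information. *)
Record protocol (R : realType) (k : nat) (X : Type) := Protocol {
  rounds : nat;
  coin : finType;
  coin_pr : coin -> R;
  coin_pr_ge0 : forall w, 0 <= coin_pr w;
  coin_pr_sum1 : \sum_w coin_pr w = 1;
  site_msg : coin -> 'I_k -> X -> seq bits -> bits;
  coord_msg : coin -> seq {ffun 'I_k -> bits} -> {ffun 'I_k -> bits};
  output : coin -> seq {ffun 'I_k -> bits} -> R;
  site_msg_prefix_free : forall w i ds x y,
    prefix (site_msg w i x ds) (site_msg w i y ds) ->
    site_msg w i x ds = site_msg w i y ds;
  coord_msg_prefix_free : forall w i us us', size us = size us' ->
    prefix (coord_msg w us i) (coord_msg w us' i) ->
    coord_msg w us i = coord_msg w us' i }.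

Section Execution.
Variables (R : realType) (k : nat) (X : Type) (P : protocol R k X).
Variables (w : coin P) (x : 'I_k -> X).

(* Chronological list, over the first t rounds, of the uplink and downlink
   messages. *)
Fixpoint transcript (t : nat) :
    seq ({ffun 'I_k -> bits} * {ffun 'I_k -> bits}) :=
  if t is t'.+1 then
    let h := transcript t' in
    let u : {ffun 'I_k -> bits} :=
      [ffun i => site_msg w i (x i) [seq (m.2 : {ffun _ -> bits}) i | m <- h]] in
    rcons h (u, coord_msg w (rcons [seq m.1 | m <- h] u))
  else [::].

Definition comm_cost : nat :=
  (\sum_(m <- transcript (rounds P)) \sum_(i < k) (size (m.1 i) + size (m.2 i)))%N.

Definition result : R := output w [seq m.1 | m <- transcript (rounds P)].

End Execution.

Definition Fp (R : realType) (n : nat) (p : R) (v : 'rV[nat]_n) : R :=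
  \sum_(j < n) (v 0 j)%:R `^ p.

Section Guarantees.
Variables (R : realType) (k n : nat) (P : protocol R k 'rV[nat]_n) (M : nat).

Definition bounded_inputs (x : 'I_k -> 'rV[nat]_n) : Prop :=
  forall i j, (x i 0%R j <= M)%N.

Definition approximates_Fp (p eps : R) : Prop :=
  forall x, bounded_inputs x ->
    2 / 3 <= \sum_(w | `|result w x - Fp p (\sum_(i < k) x i)|
                         <= eps * Fp p (\sum_(i < k) x i)) coin_pr (p := P) w.

(* Worst case over the inputs and over the coins. *)
Definition uses_at_most (b : R) : Prop :=
  forall x, bounded_inputs x -> forall w : coin P, (comm_cost w x)%:R <= b.

End Guarantees.

(* Main.v *)
Require Import Defs.
From HB Require Import structures.
From mathcomp Require Import all_boot all_order all_algebra.
From mathcomp Require Import all_classical all_reals all_analysis.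
From mathcomp Require Import ring lra zify.

Set Implicit Arguments.
Unset Strict Implicit.
Unset Printing Implicit Defensive.

Import Order.TTheory GRing.Theory Num.Theory.
Local Open Scope ring_scope.

(* Subsample the coordinates with the public coins: S_0 is everything and S_{l+1}
   keeps each element of S_l with probability 1/2.  With sgn_{l,j} = 1 - 2 [j in b_l],
   where b_l is the mask of step l, telescoping gives
     F_p = \sum_{l < L} 2^l \sum_{j in S_l} sgn_{l,j} v_j^p + 2^L F_p(v restricted to S_L),
   and S_L is empty with high probability.  The signs of level l are uniform and
   independent of S_l, so replacing v_j^p at level l by estimates w_j computed
   without b_l perturbs the inner sum, in mean square, by \sum_j (w_j - v_j^p)^2.
   It suffices that this is O((eps / L)^2 F_p(S_l)^2) in expectation.

   At one level, every site draws about T k^(p-2) coordinates, j with probability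
   proportional to v_j(i)^p, and the coordinator forms Horvitz-Thompson estimates
   of v_j.  At scale tau it drops the entries below delta tau / k: the bias is at
   most delta tau, and the variance of the rest is under control even for p > 2.
   The minimum over O(log n) independent copies rules out overestimates of the
   many light coordinates, and the maximum over the scales rules out
   underestimates of the heavy ones.  Only the O(T) best coordinates are kept,
   where T is about (L / eps)^2.  With two rounds, delta is constant and the
   second round collects the exact values of these coordinates; with one round
   delta is about eps / L, which costs the extra factor eps^-p.

   The draws of a site follow a law that depends on its input, unlike the coins
   of a protocol.  So the common random string holds one independent draw for
   every possible input of every site. *)

(** * Expectation over finite probability spaces *)

Section FiniteExpectation.
Variable R : realType.

Definition Ex (Omega : finType) (mu f : Omega -> R) : R := \sum_w mu w * f w.

Definition is_dist (Omega : finType) (mu : Omega -> R) : Prop :=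
  (forall w, 0 <= mu w) /\ \sum_w mu w = 1.

Section Basics.
Variables (Omega : finType) (mu : Omega -> R).

Lemma eq_Ex f g : f =1 g -> Ex mu f = Ex mu g.
Proof. by move=> fg; apply: eq_bigr => w _; rewrite fg. Qed.

Lemma ExD f g : Ex mu (fun w => f w + g w) = Ex mu f + Ex mu g.
Proof. by rewrite -big_split; apply: eq_bigr => w _; rewrite mulrDr. Qed.

Lemma ExZl c f : Ex mu (fun w => c * f w) = c * Ex mu f.
Proof. by rewrite mulr_sumr; apply: eq_bigr => w _; rewrite mulrCA. Qed.

Lemma ExZr c f : Ex mu (fun w => f w * c) = Ex mu f * c.
Proof. by rewrite mulrC -ExZl; apply: eq_Ex => w; rewrite mulrC. Qed.

Lemma Ex_sum (I : finType) (P : pred I) (F : I -> Omega -> R) :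
  Ex mu (fun w => \sum_(i | P i) F i w) = \sum_(i | P i) Ex mu (F i).
Proof.
by rewrite exchange_big; apply: eq_bigr => w _; rewrite mulr_sumr.
Qed.

Hypothesis mu_dist : is_dist mu.

Lemma Ex_cst c : Ex mu (fun=> c) = c.
Proof. by rewrite /Ex -mulr_suml mu_dist.2 mul1r. Qed.

Lemma ler_Ex f g : (forall w, f w <= g w) -> Ex mu f <= Ex mu g.
Proof. by move=> fg; apply: ler_sum => w _; rewrite ler_wpM2l ?mu_dist.1. Qed.

Lemma Ex_ge0 f : (forall w, 0 <= f w) -> 0 <= Ex mu f.
Proof. by move=> f0; apply: sumr_ge0 => w _; rewrite mulr_ge0 ?mu_dist.1. Qed.

Lemma Pr_compl (A : pred Omega) :
  Ex mu (fun w => (A w)%:R) = 1 - Ex mu (fun w => (~~ A w)%:R).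
Proof.
apply/eqP; rewrite eq_sym subr_eq -ExD -[X in X == _](Ex_cst 1); apply/eqP.
by apply: eq_Ex => w; case: (A w); rewrite ?addr0 ?add0r.
Qed.

End Basics.

Lemma Ex_swap (S T : finType) (mu : S -> R) (nu : T -> R) (f : S -> T -> R) :
  Ex mu (fun s => Ex nu (f s)) = Ex nu (fun t => Ex mu (f^~ t)).
Proof.
rewrite /Ex; under eq_bigr do rewrite mulr_sumr.
rewrite exchange_big; apply: eq_bigr => t _; rewrite mulr_sumr.
by apply: eq_bigr => s _; rewrite mulrCA.
Qed.

Definition pair_pr (S T : finType) (mu : S -> R) (nu : T -> R) (w : S * T) : R :=
  mu w.1 * nu w.2.

Lemma Ex_pair_pr (S T : finType) (mu : S -> R) (nu : T -> R) f :
  Ex (pair_pr mu nu) f = Ex mu (fun s => Ex nu (fun t => f (s, t))).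
Proof.
transitivity (\sum_s \sum_t mu s * nu t * f (s, t)).
  by rewrite pair_bigA; apply: eq_bigr => -[s t] _.
apply: eq_bigr => s _; rewrite mulr_sumr; apply: eq_bigr => t _.
by rewrite mulrA.
Qed.

Lemma pair_pr_dist (S T : finType) (mu : S -> R) (nu : T -> R) :
  is_dist mu -> is_dist nu -> is_dist (pair_pr mu nu).
Proof.
move=> muD nuD; split=> [w|]; first by rewrite mulr_ge0 ?muD.1 ?nuD.1.
transitivity (Ex (pair_pr mu nu) (fun=> 1)).
  by apply: eq_bigr => w _; rewrite mulr1.
by rewrite Ex_pair_pr !Ex_cst.
Qed.

(** * Product laws: marginals, independence and additivity of the variance *)

Section Product.
Variables (K Z : finType) (D : K -> Z -> R).
Hypothesis D_dist : forall k, is_dist (D k).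

Definition prod_pr (w : {ffun K -> Z}) : R := \prod_k D k (w k).

Lemma Ex_prod (h : K -> Z -> R) :
  Ex prod_pr (fun w => \prod_k h k (w k)) = \prod_k Ex (D k) (h k).
Proof.
by rewrite /Ex bigA_distr_bigA; apply: eq_bigr => w _; rewrite -big_split.
Qed.

Lemma prod_pr_dist : is_dist prod_pr.
Proof.
split=> [w|]; first by apply: prodr_ge0 => k _; apply: (D_dist k).1.
transitivity (Ex prod_pr (fun w => \prod_(k : K) (fun _ _ => 1 : R) k (w k))).
  by apply: eq_bigr => w _; rewrite big1 // mulr1.
by rewrite (Ex_prod (fun _ _ => 1)) big1 // => k _; rewrite Ex_cst.
Qed.

Lemma Ex_coord k (h : Z -> R) : Ex prod_pr (fun w => h (w k)) = Ex (D k) h.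
Proof.
pose H k' z := if k' == k then h z else 1.
transitivity (Ex prod_pr (fun w => \prod_k' H k' (w k'))).
  apply: eq_Ex => w; rewrite (bigD1 k) //= /H eqxx big1 ?mulr1 // => k' nk.
  by rewrite (negbTE nk).
rewrite Ex_prod (bigD1 k) //= big1 ?mulr1; last first.
  by move=> k' /negbTE nk; rewrite /H nk Ex_cst.
by apply: eq_Ex => z; rewrite /H eqxx.
Qed.

Lemma Ex_coord2 k1 k2 (h1 h2 : Z -> R) : k1 != k2 ->
  Ex prod_pr (fun w => h1 (w k1) * h2 (w k2)) = Ex (D k1) h1 * Ex (D k2) h2.
Proof.
move=> nk12.
pose H k' z := if k' == k1 then h1 z else if k' == k2 then h2 z else 1.
have nk21 : (k2 == k1) = false by rewrite eq_sym (negbTE nk12).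
transitivity (Ex prod_pr (fun w => \prod_k' H k' (w k'))).
  apply: eq_Ex => w; rewrite (bigD1 k1) //= (bigD1 k2) /=; last by rewrite eq_sym.
  rewrite /H !eqxx nk21 big1 ?mulr1 // => k' /andP[n1 n2].
  by rewrite (negbTE n1) (negbTE n2).
rewrite Ex_prod (bigD1 k1) //= (bigD1 k2) /=; last by rewrite eq_sym.
rewrite big1 ?mulr1; last first.
  by move=> k' /andP[/negbTE n1 /negbTE n2]; rewrite /H n1 n2 Ex_cst.
by congr (_ * _); apply: eq_Ex => z; rewrite /H ?eqxx ?nk21.
Qed.

(** Cross terms vanish because distinct coordinates are independent and each [X i] is centred. The
    injection [key] selects the coordinates that are read: later, the draws made for the actual
    inputs. *)
Lemma Ex_sqr_sum_coord (I : finType) (key : I -> K) (X : I -> Z -> R) :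
  injective key -> (forall i, Ex (D (key i)) (X i) = 0) ->
  Ex prod_pr (fun w => (\sum_i X i (w (key i))) ^+ 2)
  = \sum_i Ex (D (key i)) (fun z => X i z ^+ 2).
Proof.
move=> key_inj X0.
transitivity (\sum_i \sum_i' Ex prod_pr (fun w => X i (w (key i)) * X i' (w (key i')))).
  under [RHS]eq_bigr do rewrite -Ex_sum.
  rewrite -Ex_sum; apply: eq_Ex => w; rewrite expr2 mulr_suml.
  by apply: eq_bigr => i _; rewrite mulr_sumr.
apply: eq_bigr => i _; rewrite (bigD1 i) //= big1 ?addr0.
  rewrite (Ex_coord (key i) (fun z => X i z * X i z)).
  by apply: eq_Ex => z; rewrite expr2.
move=> i' ni'; rewrite Ex_coord2 ?X0 ?mul0r //.
by rewrite (inj_eq key_inj) eq_sym.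
Qed.

End Product.
End FiniteExpectation.

(** * Nested subsampling *)

Section Subsampling.
Variables (R : realType) (n L : nat).

(** Markov's inequality with a product in place of a quotient, so as to cover [t = 0], the case of a
    zero moment: [X] then vanishes wherever [mu] has mass. *)
Lemma markov_le (Omega : finType) (mu X : Omega -> R) (t d : R) :
  is_dist mu -> 0 <= d -> 0 <= t -> (forall w, 0 <= X w) ->
  Ex mu X <= d * t -> Ex mu (fun w => (t < X w)%R%:R) <= d.
Proof.
move=> muD d0 t0 X0; rewrite le_eqVlt in t0; case/predU1P: t0 => [<-|t0].
  rewrite mulr0 => EX; rewrite /Ex big1 // => w _.
  have /eqP : mu w * X w = 0.
    apply/eqP; rewrite eq_le mulr_ge0 ?muD.1 // andbT; apply: le_trans EX.
    by rewrite /Ex (bigD1 w) //= lerDl sumr_ge0 // => *; rewrite mulr_ge0 ?muD.1.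
  by rewrite mulf_eq0 => /orP[] /eqP->; rewrite ?mul0r // ltxx mulr0.
rewrite -ler_pdivrMr // => EX; apply: le_trans EX; rewrite -ExZr.
apply: (ler_Ex muD) => w; case: ltP => [lt_X|_].
  by rewrite ler_pdivlMr // mul1r ltW.
by rewrite divr_ge0 ?X0 // ltW.
Qed.

Definition masks : finType := {ffun 'I_L -> {set 'I_n}}.
Definition mask_pr (b : masks) : R := #|masks|%:R^-1.
Implicit Type b : masks.

Definition survivors b (l : nat) : {set 'I_n} :=
  [set j | [forall l' : 'I_L, (l' < l)%N ==> (j \in b l')]].
Definition sgn b (l : 'I_L) j : R := 1 - 2 * (j \in b l)%:R.
(** A measure-preserving involution that leaves the masks of all other steps alone, hence also
    [survivors b l]. *)
Definition flip (l : 'I_L) (j : 'I_n) b : masks :=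
  [ffun l' => if l' == l then [set j' | (j' \in b l') (+) (j' == j)] else b l'].

Lemma mask_pr_dist : is_dist mask_pr.
Proof.
have m0 : (0 < #|masks|)%N by apply/card_gt0P; exists [ffun=> finset.set0].
split=> [b|]; first by rewrite invr_ge0.
by rewrite /mask_pr sumr_const -[LHS]mulr_natl divff // pnatr_eq0 -lt0n.
Qed.

Lemma flipK l j : involutive (flip l j).
Proof.
move=> b; apply/ffunP => l'; rewrite !ffunE; case: eqP => // _.
by apply/setP => j'; rewrite !inE addbK.
Qed.

Lemma Ex_flip l j f : Ex mask_pr (fun b => f (flip l j b)) = Ex mask_pr f.
Proof. by rewrite [RHS]/Ex (reindex_inj (can_inj (flipK l j))). Qed.

Lemma survivors_flip (l : 'I_L) j b : survivors (flip l j b) l = survivors b l.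
Proof.
apply/setP => j'; rewrite !inE; apply: eq_forallb => l'.
case: ltnP => //= lt_l; rewrite ffunE ifN //.
by apply: contraTneq lt_l => ->; rewrite ltnn.
Qed.

Lemma mem_flip l j b j' : (j' \in flip l j b l) = (j' \in b l) (+) (j' == j).
Proof. by rewrite ffunE eqxx inE. Qed.

Lemma survivors0 b : survivors b 0 = [set: 'I_n].
Proof. by apply/setP => j; rewrite !inE; apply/forallP. Qed.

Lemma survivorsS b (l : 'I_L) j :
  (j \in survivors b l.+1) = (j \in survivors b l) && (j \in b l).
Proof.
rewrite !inE; apply/forallP/andP => [h|[/forallP h hl] l'].
  split; last by have /implyP := h l; apply.
  by apply/forallP => l'; apply/implyP => lt_l; have /implyP := h l'; apply; exact: ltnW.
apply/implyP; rewrite ltnS leq_eqVlt => /orP[/eqP/val_inj-> //|].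
exact/implyP.
Qed.

Lemma Ex_survivor j l : (l <= L)%N ->
  Ex mask_pr (fun b => (j \in survivors b l)%:R) = 2^-1 ^+ l.
Proof.
elim: l => [|l IH] lL.
  under eq_Ex do rewrite survivors0 inE.
  by rewrite Ex_cst //; exact: mask_pr_dist.
pose o := Ordinal lL; have := IH (ltnW lL).
(* If [j] survived so far, exactly one of [b] and [flip o j b] keeps it at the next step. *)
have -> : Ex mask_pr (fun b => (j \in survivors b l)%:R)
    = Ex mask_pr (fun b => (j \in survivors b l.+1)%:R) * 2.
  rewrite mulr2n mulrDr mulr1 -[X in _ = _ + X](Ex_flip o j) -ExD; apply: eq_Ex => b.
  rewrite !(survivorsS _ o) (survivors_flip o) mem_flip eqxx addbT.
  by case: (j \in survivors b _); case: (j \in b o); rewrite /= ?addr0 ?add0r.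
by rewrite exprS => <-; rewrite mulrC mulfK // pnatr_eq0.
Qed.

(** Flipping [j] in mask [l] negates a cross term of [j] and [j'] and preserves the law, so each
    cross term has mean zero; on the diagonal the signs square to 1. The coefficients may depend on
    the survivors because the flip does not move them. *)
Lemma Ex_sgn_sqr (l : 'I_L) (h : {set 'I_n} -> R) (a : {set 'I_n} -> 'I_n -> R) :
  Ex mask_pr (fun b => h (survivors b l) *
     (\sum_j sgn b l j * a (survivors b l) j) ^+ 2)
  = Ex mask_pr (fun b => h (survivors b l) * \sum_j a (survivors b l) j ^+ 2).
Proof.
pose G j j' b := h (survivors b l) * (sgn b l j * a (survivors b l) j)
   * (sgn b l j' * a (survivors b l) j').
transitivity (\sum_j \sum_j' Ex mask_pr (G j j')).
  under [RHS]eq_bigr do rewrite -Ex_sum.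
  rewrite -Ex_sum; apply: eq_Ex => b; rewrite expr2 mulrA [X in X * _]mulr_sumr mulr_suml.
  by apply: eq_bigr => j _; rewrite mulr_sumr.
under [RHS]eq_Ex do rewrite mulr_sumr.
rewrite Ex_sum; apply: eq_bigr => j _; rewrite (bigD1 j) //= big1 ?addr0.
  apply: eq_Ex => b; rewrite /G /sgn; case: (j \in b l) => /=; ring.
move=> j' nj.
have E2 : Ex mask_pr (G j j') = - Ex mask_pr (G j j').
  rewrite -[LHS](Ex_flip l j) -mulN1r -ExZl; apply: eq_Ex => b.
  rewrite /G /sgn survivors_flip !mem_flip eqxx (negbTE nj) addbT addbF.
  by case: (j \in b l) => /=; ring.
by move: (Ex _ _) E2 => x; lra.
Qed.

(** * Error of one level and of the telescoped sum *)

Variables (W : finType) (nu : W -> R) (u : 'I_n -> R)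
  (g : {set 'I_n} -> W -> 'I_n -> R) (beta : R).
Hypotheses (nu_dist : is_dist nu) (u_ge0 : forall j, 0 <= u j) (beta_ge0 : 0 <= beta).
Hypothesis g_error : forall S,
  Ex nu (fun w => \sum_j (g S w j - (j \in S)%:R * u j) ^+ 2)
  <= (beta * \sum_j (j \in S)%:R * u j) ^+ 2.

Definition level_error b (l : 'I_L) w : R :=
  \sum_j sgn b l j * (g (survivors b l) w j - (j \in survivors b l)%:R * u j).

(* AM-GM against a bound [d] depending on the surviving set only: it turns the
   mean square given the survivors into a mean absolute value. *)
Lemma Ex_level_error (l : 'I_L) :
  Ex mask_pr (fun b => Ex nu (fun w => `|level_error b l w|))
  <= beta * (2^-1 ^+ l * \sum_j u j).
Proof.
have muD := mask_pr_dist.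
pose m (S : {set 'I_n}) : R := beta * \sum_j (j \in S)%:R * u j.
have m0 S : 0 <= m S.
  by rewrite mulr_ge0 ?sumr_ge0 // => j _; rewrite mulr_ge0.
have Em : Ex mask_pr (fun b => m (survivors b l)) = beta * (2^-1 ^+ l * \sum_j u j).
  rewrite ExZl Ex_sum [X in _ = _ * X]mulr_sumr; congr (_ * _); apply: eq_bigr => j _.
  by rewrite ExZr Ex_survivor // ltnW.
(* The slack [e] keeps [d S] positive when [m S] is zero, for instance when nothing survives. *)
rewrite -Em; apply/ler_addgt0Pr => e e0.
pose d S := m S + e; have d0 S : 0 < d S by rewrite ltr_wpDl.
apply: (@le_trans _ _ (Ex mask_pr (fun b => Ex nu (fun w =>
    2^-1 * ((d (survivors b l))^-1 * level_error b l w ^+ 2) + 2^-1 * d (survivors b l))))).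
  apply: (ler_Ex muD) => b; apply: (ler_Ex nu_dist) => w.
  set x := level_error b l w; set c := d _; have c0 : 0 < c by exact: d0.
  have : 0 <= c^-1 * (`|x| - c) ^+ 2 by rewrite mulr_ge0 ?sqr_ge0 // invr_ge0 ltW.
  have -> : c^-1 * (`|x| - c) ^+ 2 = c^-1 * `|x| ^+ 2 - 2 * `|x| + c.
    by field; rewrite gt_eqF.
  by rewrite real_normK ?num_real //; lra.
have -> : Ex mask_pr (fun b => Ex nu (fun w =>
    2^-1 * ((d (survivors b l))^-1 * level_error b l w ^+ 2) + 2^-1 * d (survivors b l)))
  = 2^-1 * Ex mask_pr (fun b => (d (survivors b l))^-1 * Ex nu (fun w =>
      \sum_j (g (survivors b l) w j - (j \in survivors b l)%:R * u j) ^+ 2))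
    + 2^-1 * Ex mask_pr (fun b => d (survivors b l)).
  under eq_Ex do rewrite ExD ExZl (Ex_cst nu_dist).
  (* Exchanging the expectations lets the signs cancel for each fixed draw; exchanging back makes
     [g_error] available for each fixed mask. *)
  rewrite ExD !ExZl; congr (_ * _ + _); rewrite Ex_swap.
  under eq_Ex do rewrite (Ex_sgn_sqr l (fun S => (d S)^-1)
     (fun S j => g S _ j - (j \in S)%:R * u j)).
  by rewrite -Ex_swap; apply: eq_Ex => b; rewrite ExZl.
apply: (@le_trans _ _ (2^-1 * Ex mask_pr (fun b => m (survivors b l))
   + 2^-1 * Ex mask_pr (fun b => m (survivors b l) + e))).
  rewrite lerD2r ler_pM2l ?invr_gt0 //; apply: (ler_Ex muD) => b.
  rewrite mulrC ler_pdivrMr // (le_trans (g_error _)) //.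
  by rewrite -/(m _) expr2 ler_wpM2l // lerDl ltW.
by rewrite ExD (Ex_cst muD); lra.
Qed.

Definition subsampled_sum b (w : {ffun 'I_L -> W}) : R :=
  \sum_(l < L) 2 ^+ l * \sum_j sgn b l j * g (survivors b l) (w l) j.

(** The signed sum of level [l], scaled by [2 ^+ l], is exactly [A l - A l.+1], since a survivor of
    level [l] passes to the next one iff it lies in the mask. *)
Lemma sum_telescope b : \sum_j u j
  = \sum_(l < L) 2 ^+ l * (\sum_j sgn b l j * ((j \in survivors b l)%:R * u j))
    + 2 ^+ L * \sum_j (j \in survivors b L)%:R * u j.
Proof.
pose A l := 2 ^+ l * \sum_j (j \in survivors b l)%:R * u j : R.
have -> : \sum_j u j = A 0%N.
  rewrite /A expr0 mul1r; apply: eq_bigr => j _.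
  by rewrite survivors0 inE mul1r.
rewrite -/(A L); apply/eqP; rewrite -subr_eq -opprB -(telescope_sumr A) //.
rewrite big_mkord -sumrN; apply/eqP; apply: eq_bigr => l _.
rewrite opprB /A exprS -mulrA mulrCA -mulrBr; congr (_ * _).
rewrite mulr_sumr -sumrB; apply: eq_bigr => j _; rewrite survivorsS /sgn.
by case: (_ \in survivors _ _); case: (_ \in b l) => /=; ring.
Qed.

(** Two failure events: a nonempty last level, by a union bound over the coordinates, and a large
    [X], by Markov. The factor [2 ^+ l] cancels the halving of the expected mass, so every level
    contributes [beta * U] to the mean of [X]. *)
Lemma subsampled_sum_pr (eps : R) : 0 < eps ->
  1 - n%:R * 2^-1 ^+ L - L%:R * beta / eps
  <= Ex (pair_pr mask_pr (prod_pr (fun=> nu)))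
       (fun bw => (`|subsampled_sum bw.1 bw.2 - \sum_j u j|
                    <= eps * \sum_j u j)%R%:R).
Proof.
move=> eps0; have muD := mask_pr_dist.
have wD : is_dist (prod_pr (fun=> nu) : {ffun 'I_L -> W} -> R).
  by apply: prod_pr_dist.
have bwD := pair_pr_dist muD wD.
set mu := pair_pr _ _ in bwD *; set U := \sum_j u j.
have U0 : 0 <= U by apply: sumr_ge0.
pose X (bw : masks * {ffun 'I_L -> W}) : R :=
  \sum_(l < L) 2 ^+ l * `|level_error bw.1 l (bw.2 l)|.
have X0 bw : 0 <= X bw.
  by apply: sumr_ge0 => l _; rewrite mulr_ge0 ?exprn_ge0.
pose empt (bw : masks * {ffun 'I_L -> W}) := survivors bw.1 L == finset.set0.
have good bw : empt bw -> `|subsampled_sum bw.1 bw.2 - U| <= X bw.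
  case: bw => b w /eqP /= S0; rewrite /U (sum_telescope b) S0.
  rewrite [X in 2 ^+ L * X]big1 ?mulr0 ?addr0; last by move=> j _; rewrite inE mul0r.
  rewrite -sumrB; apply: le_trans (ler_norm_sum _ _ _) _.
  apply: ler_sum => l _; rewrite -mulrBr normrM ger0_norm ?exprn_ge0 //.
  by rewrite -sumrB; under eq_bigr do rewrite -mulrBr.
have EX : Ex mu X <= (L%:R * beta / eps) * (eps * U).
  rewrite mulrA divfK ?gt_eqF // Ex_sum.
  have -> : L%:R * beta * U = \sum_(l < L) beta * U.
    by rewrite sumr_const card_ord -[RHS]mulr_natl mulrA.
  apply: ler_sum => l _; rewrite ExZl Ex_pair_pr /=.
  under eq_Ex do rewrite (Ex_coord _ _ (fun z => `|level_error _ l z|)) //.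
  apply: le_trans (ler_wpM2l _ (Ex_level_error l)) _; first by rewrite exprn_ge0.
  by rewrite -/U exprVn mulrCA mulVKf // gt_eqF // exprn_gt0.
have d0 : 0 <= L%:R * beta / eps by rewrite divr_ge0 ?mulr_ge0 // ltW.
have PX := markov_le bwD d0 (mulr_ge0 (ltW eps0) U0) X0 EX.
have PS : Ex mu (fun bw => (~~ empt bw)%:R) <= n%:R * 2^-1 ^+ L.
  have -> : n%:R * 2^-1 ^+ L = \sum_(j < n) 2^-1 ^+ L :> R.
    by rewrite sumr_const card_ord mulr_natl.
  rewrite -(eq_bigr _ (fun j _ => Ex_survivor j (leqnn L))) -Ex_sum Ex_pair_pr.
  apply: (ler_Ex muD) => b; rewrite /empt /= Ex_cst //.
  case: (finset.set_0Vmem (survivors b L)) => [->|[j jS]].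
    by rewrite eqxx sumr_ge0.
  rewrite (bigD1 j) //= jS; apply: ler_wpDr; first exact: sumr_ge0.
  by case: (_ == _).
rewrite Pr_compl // -addrA lerD2l -opprD lerN2.
apply: le_trans (lerD PS PX); rewrite -ExD; apply: (ler_Ex bwD) => bw.
rewrite -ltNge; case: (boolP (empt bw)) => [/good le_X|_]; last first.
  by apply: ler_wpDr => //; rewrite ler_nat leq_b1.
rewrite /= add0r; case: (ltP (eps * U)) => [lt1|_]; last by [].
by rewrite (lt_le_trans lt1 le_X).
Qed.

End Subsampling.

(** * Protocols with fixed-length messages *)

Section FixedLengthCode.
Variables (U : finType) (b : nat).

(** The default word also has length [b], so all code words have equal length whatever the size of
    [U], and prefix-freeness needs no cardinality bound. *)
Definition encode (u : U) : bits :=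
  nth (nseq b false) [seq val t | t <- enum {: b.-tuple bool}] (enum_rank u).

Definition decode (u0 : U) (s : bits) : U := odflt u0 [pick u | encode u == s].

Lemma size_encode u : size (encode u) = b.
Proof.
rewrite /encode; set s := map _ _.
have [lt_s|ge_s] := ltnP (enum_rank u) (size s); last by rewrite nth_default ?size_nseq.
by have /mapP[t _ ->] := mem_nth (nseq b false) lt_s; rewrite size_tuple.
Qed.

Lemma encodeK u0 : (#|U| <= 2 ^ b)%N -> cancel encode (decode u0).
Proof.
move=> le_U u; rewrite /decode; case: pickP => [u' /eqP|/(_ u)]; last by rewrite eqxx.
have sz (v : U) : (enum_rank v < size [seq val t | t <- enum {: b.-tuple bool}])%N.
  rewrite size_map -cardE card_tuple card_bool.
  exact: leq_trans (ltn_ord _) le_U.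
move=> /eqP; rewrite nth_uniq // ?(map_inj_uniq val_inj) ?enum_uniq //.
by move=> /eqP/val_inj/enum_rank_inj.
Qed.

End FixedLengthCode.

Lemma prefix_eq_size (T : eqType) (s t : seq T) :
  size s = size t -> prefix s t -> s = t.
Proof. by move=> st; rewrite prefixE st take_size => /eqP ->. Qed.

Section TypedProtocols.
Variables (R : realType) (k : nat) (X : Type) (coins : finType) (pr : coins -> R).
Hypothesis pr_dist : is_dist pr.

Section OneRound.
Variables (U : finType) (u0 : U) (b : nat).
Variables (up : coins -> 'I_k -> X -> U) (out : coins -> {ffun 'I_k -> U} -> R).

Definition one_round_site (w : coins) (i : 'I_k) (x : X) (ds : seq bits) : bits :=
  encode b (up w i x).

Definition one_round_output (w : coins) (us : seq {ffun 'I_k -> bits}) : R :=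
  if us is [:: u] then out w [ffun i => decode b u0 (u i)] else 0.

Lemma one_round_site_prefix_free w i ds x y :
  prefix (one_round_site w i x ds) (one_round_site w i y ds) ->
  one_round_site w i x ds = one_round_site w i y ds.
Proof. by apply: prefix_eq_size; rewrite !size_encode. Qed.

Definition one_round : protocol R k X :=
  @Protocol R k X 1 coins pr pr_dist.1 pr_dist.2 one_round_site
    (fun _ _ => [ffun=> [::]]) one_round_output one_round_site_prefix_free
    (fun _ _ _ _ _ _ => erefl).

Hypothesis le_U : (#|U| <= 2 ^ b)%N.

Lemma one_round_result (w : coins) x :
  result (P := one_round) w x = out w [ffun i => up w i (x i)].
Proof.
by rewrite /result /=; congr out; apply/ffunP => i; rewrite !ffunE encodeK.
Qed.

Lemma one_round_cost (w : coins) x : comm_cost (P := one_round) w x = (k * b)%N.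
Proof.
rewrite /comm_cost /= big_seq1 -[k in RHS]card_ord -sum_nat_const.
by apply: eq_bigr => i _; rewrite /= !ffunE size_encode addn0.
Qed.

End OneRound.

Section TwoRound.
Variables (U Q V : finType) (u0 : U) (q0 : Q) (v0 : V) (b1 b2 b3 : nat).
Variables (up : coins -> 'I_k -> X -> U) (ask : coins -> {ffun 'I_k -> U} -> Q).
Variables (reply : coins -> 'I_k -> X -> Q -> V).
Variable out : coins -> {ffun 'I_k -> U} -> {ffun 'I_k -> V} -> R.

Definition two_round_site (w : coins) (i : 'I_k) (x : X) (ds : seq bits) : bits :=
  if ds is d :: _ then encode b3 (reply w i x (decode b2 q0 d))
  else encode b1 (up w i x).

Definition two_round_coord (w : coins) (us : seq {ffun 'I_k -> bits}) :
    {ffun 'I_k -> bits} :=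
  if us is [:: u] then
    [ffun=> encode b2 (ask w [ffun i => decode b1 u0 (u i)])]
  else [ffun=> [::]].

Definition two_round_output (w : coins) (us : seq {ffun 'I_k -> bits}) : R :=
  if us is [:: u; v] then
    out w [ffun i => decode b1 u0 (u i)] [ffun i => decode b3 v0 (v i)]
  else 0.

Lemma two_round_site_prefix_free w i ds x y :
  prefix (two_round_site w i x ds) (two_round_site w i y ds) ->
  two_round_site w i x ds = two_round_site w i y ds.
Proof. by apply: prefix_eq_size; case: ds => [|d ds]; rewrite !size_encode. Qed.

Lemma two_round_coord_prefix_free w i us us' : size us = size us' ->
  prefix (two_round_coord w us i) (two_round_coord w us' i) ->
  two_round_coord w us i = two_round_coord w us' i.
Proof.
move=> sz; apply: prefix_eq_size.
by case: us us' sz => [|u [|? ?]] [|u' [|? ?]] //= _; rewrite !ffunE ?size_encode.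
Qed.

Definition two_round : protocol R k X :=
  @Protocol R k X 2 coins pr pr_dist.1 pr_dist.2 two_round_site two_round_coord
    two_round_output two_round_site_prefix_free two_round_coord_prefix_free.

Hypotheses (le_U : (#|U| <= 2 ^ b1)%N) (le_Q : (#|Q| <= 2 ^ b2)%N)
  (le_V : (#|V| <= 2 ^ b3)%N).

Lemma two_round_result (w : coins) x :
  result (P := two_round) w x =
  let u := [ffun i => up w i (x i)] in
  out w u [ffun i => reply w i (x i) (ask w u)].
Proof.
have us : [ffun i => decode b1 u0 ([ffun i => encode b1 (up w i (x i))] i)]
    = [ffun i => up w i (x i)] by apply/ffunP => i; rewrite !ffunE encodeK.
rewrite /result /= us; congr out; apply/ffunP => i.
by rewrite !ffunE !encodeK.
Qed.

Lemma two_round_cost (w : coins) x :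
  comm_cost (P := two_round) w x = (k * (b1 + b2 + b3))%N.
Proof.
rewrite /comm_cost /= big_cons big_seq1 -big_split -[k in RHS]card_ord -sum_nat_const.
by apply: eq_bigr => i _; rewrite /= !ffunE !size_encode /= addn0.
Qed.

End TwoRound.
End TypedProtocols.

(** * Estimation at one subsampling level *)

Section PowerInequalities.
Variable R : realType.
Implicit Types (x y p : R).

Lemma ler_of_eq x y : x = y -> x <= y.
Proof. by move=> ->. Qed.

Lemma powR_inv x p : 0 <= x -> x^-1 `^ p = (x `^ p)^-1.
Proof. by move=> x0; rewrite -(powR_inv1 x0) powRAC powR_inv1 ?powR_ge0. Qed.

Lemma sqr_div_powR x p : 0 < x -> x ^+ 2 / x `^ p = (x `^ (p - 2))^-1.
Proof.
move=> x0; rewrite powRB ?(gt_eqF x0) ?implybT //.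
by rewrite (powR_mulrn 2 (ltW x0)) invf_div.
Qed.

Lemma ler_powR_base x y p : 0 <= p -> 0 <= x -> x <= y -> x `^ p <= y `^ p.
Proof.
by move=> p0 x0 xy; apply: ge0_ler_powR; rewrite ?nnegrE // (le_trans x0).
Qed.

(** The function is the power 2 - p, antitone for [2 <= p]. Hence a lower cut on the entries bounds
    the second moment of a draw. *)
Lemma sqr_div_powR_le x y p : 2 <= p -> 0 < x -> x <= y ->
  y ^+ 2 / y `^ p <= x ^+ 2 / x `^ p.
Proof.
move=> p2 x0 xy; have y0 := lt_le_trans x0 xy.
rewrite !sqr_div_powR // lef_pV2 ?posrE ?powR_gt0 //.
by rewrite ler_powR_base ?subr_ge0 // ltW.
Qed.

(** Split one factor [a i] off its power and bound the remaining power p - 1 by that of the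
    total. *)
Lemma sum_powR_le (I : finType) (a : I -> R) p : 1 <= p -> (forall i, 0 <= a i) ->
  \sum_i a i `^ p <= (\sum_i a i) `^ p.
Proof.
move=> p1 a0; have p0 : 0 < p by apply: lt_le_trans p1.
have S0 : 0 <= \sum_i a i by apply: sumr_ge0.
rewrite -(mulr_powRB1 S0 p0) mulr_suml; apply: ler_sum => i _.
rewrite -(mulr_powRB1 (a0 i) p0) ler_wpM2l //.
apply: ler_powR_base; rewrite ?subr_ge0 //.
by rewrite (bigD1 i) //= lerDl sumr_ge0.
Qed.

Lemma powR_le_exprn x p (q : nat) : 1 <= x -> p <= q%:R -> x `^ p <= x ^+ q.
Proof.
move=> x1 pq; rewrite -powR_mulrn ?(le_trans _ x1) //.
exact: ler_powR.
Qed.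

Lemma powR_nat_le_exprn (a : nat) p (q : nat) : 0 < p -> p <= q%:R ->
  a%:R `^ p <= a%:R ^+ q :> R.
Proof.
move=> p0 pq; case: a => [|a]; last by rewrite powR_le_exprn ?ler1n.
by rewrite powR0 ?gt_eqF // exprn_ge0.
Qed.

End PowerInequalities.

(** * Messages, scales and estimators of one level *)

Section Level.
(** [c] is the number of independent copies, [B] of draws per site and copy, [N] the capacity for
    candidates, [Sm] the number of scales, and [q] an integer above [p] that replaces it in alphabet
    sizes and constants. *)
Variables (R : realType) (n k M c B N Sm q : nat) (p delta T : R).

Definition inp : finType := {ffun 'I_n -> 'I_M.+1}.
(** The first component is the rounded moment of the site, the second gives each sampled coordinate
    together with its value. *)
Definition level_msg : finType :=
  ('I_(n * M ^ q).+1 * {ffun 'I_c * 'I_B -> option ('I_n * 'I_M.+1)})%type.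

Definition norm_p (y : inp) : R := \sum_j (y j)%:R `^ p.
(* Since [norm_ceil 0 = 0] and x / 0 = 0, the zero input always draws [None]. *)
Definition norm_ceil (y : inp) : nat := `|Num.ceil (norm_p y)|%N.
(** The normaliser is an integer so that it can be sent exactly, which keeps the estimates free of
    rounding bias; the missing mass goes to [None]. *)
Definition draw_pr (y : inp) (z : option 'I_n) : R :=
  if z is Some j then (y j)%:R `^ p / (norm_ceil y)%:R
  else 1 - norm_p y / (norm_ceil y)%:R.

(** The lowest scale [1 / T] is small enough that T times its power p is at most 1, which
    [base_scale_exists] needs. *)
Definition tau (s : nat) : R := 2 ^+ s / T.
(** Dropping entries below the cut at all [k] sites loses at most [delta * tau s] of a frequency. *)
Definition cut (s : nat) : R := delta * tau s / k%:R.

(** Horvitz-Thompson weight, value over sampling probability, up to the normaliser that [estimate]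
    takes from the first component of the message. *)
Definition weight s (j : 'I_n) (z : option ('I_n * 'I_M.+1)) : R :=
  if z is Some (j', a) then
    ((j' == j) && (cut s <= a%:R))%:R * (a%:R / a%:R `^ p)
  else 0.

Section Coordinator.
Variable m : 'I_k -> level_msg.
Definition estimate s r j : R :=
  \sum_i (m i).1%:R / B%:R * \sum_t weight s j ((m i).2 (r, t)).
(** The default value is a cap that limits the damage of an overestimate; it does no harm at the
    scale where the frequency is below [4 * tau s]. *)
Definition min_estimate s j : R := \big[Num.min/4 * tau s]_r estimate s r j.
(** Collecting all scales from [s] upwards makes these sets nested. *)
Definition level_set (s : nat) : {set 'I_n} :=
  [set j | [exists s' : 'I_Sm, (s <= s')%N && (tau s' <= min_estimate s' j)]].
(* The largest level set with at most [N] elements. *)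
Definition candidates : {set 'I_n} :=
  [set j | [exists s : 'I_Sm, (#|level_set s| <= N)%N && (j \in level_set s)]].
Definition power_estimate j : R :=
  \big[Num.max/0]_(s < Sm | tau s <= min_estimate s j) min_estimate s j `^ p.
End Coordinator.

Definition draws : finType := {ffun 'I_k * 'I_B * inp -> option 'I_n}.
Definition level_draws : finType := {ffun 'I_c -> draws}.
Definition draws_pr : draws -> R := prod_pr (fun key => draw_pr key.2).
Definition level_draws_pr : level_draws -> R := prod_pr (fun=> draws_pr).
Definition level_site_msg (y : inp) (i : 'I_k) (w : level_draws) : level_msg :=
  (inord (norm_ceil y),
   [ffun rt => omap (fun j => (j, y j)) (w rt.1 (i, rt.2, y))]).

Hypotheses (p_ge2 : 2 <= p) (p_le_q : p <= q%:R).

Let p_gt0 : 0 < p. Proof. by rewrite (lt_le_trans _ p_ge2). Qed.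
Let p_ge1 : 1 <= p. Proof. by rewrite (le_trans _ p_ge2) // ler1n. Qed.

Implicit Type y : inp.

Lemma norm_p_ge0 y : 0 <= norm_p y.
Proof. by apply: sumr_ge0 => j _; exact: powR_ge0. Qed.

Lemma norm_ceilE y : (norm_ceil y)%:R = (Num.ceil (norm_p y))%:~R :> R.
Proof.
rewrite /norm_ceil natr_absz ger0_norm //.
by rewrite -(ler_int R) (le_trans (norm_p_ge0 y)) // ceil_ge.
Qed.

Lemma norm_p_le_ceil y : norm_p y <= (norm_ceil y)%:R.
Proof. by rewrite norm_ceilE; exact: ceil_ge. Qed.

Lemma norm_p_coord y j : (y j)%:R `^ p <= norm_p y.
Proof.
by rewrite /norm_p (bigD1 j) //= lerDl sumr_ge0 // => *; exact: powR_ge0.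
Qed.

Lemma norm_p_ge1 y j : (0 < y j)%N -> 1 <= norm_p y.
Proof.
move=> yj0; apply: le_trans (norm_p_coord y j).
apply: (@le_trans _ _ (1 `^ p)); first by rewrite powR1.
by apply: ler_powR_base; rewrite ?ler1n // ltW.
Qed.

(** A nonzero integer vector has moment at least 1, so rounding up at most doubles it; the zero
    vector is rounded to 0. *)
Lemma norm_ceil_le y : (norm_ceil y)%:R <= 2 * norm_p y.
Proof.
have [j yj0|y0] := pickP (fun j => (0 < y j)%N).
  have := norm_p_ge1 yj0; have := ceilB1_lt (norm_p y).
  by rewrite norm_ceilE rmorphB /=; lra.
have f0 : norm_p y = 0.
  rewrite /norm_p big1 // => j _; have := y0 j; rewrite lt0n => /negbFE/eqP->.
  by rewrite powR0 // gt_eqF.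
by rewrite norm_ceilE f0 ceil0 mulr0.
Qed.

Lemma norm_ceil_bound y : (norm_ceil y < (n * M ^ q).+1)%N.
Proof.
rewrite ltnS -(ler_nat R) norm_ceilE -[leRHS]/((n * M ^ q)%N%:Z%:~R) ler_int.
rewrite ceil_le_int -[leRHS]/((n * M ^ q)%:R) natrM natrX /norm_p.
rewrite mulr_natl -[n in _ *+ n]card_ord -sumr_const; apply: ler_sum => j _.
apply: le_trans (powR_nat_le_exprn _ _ p_le_q) _ => //.
by rewrite lerXn2r ?nnegrE // ler_nat -ltnS.
Qed.

Lemma draw_pr_dist y : is_dist (draw_pr y).
Proof.
have g0 : 0 <= (norm_ceil y)%:R :> R by [].
split=> [[j|]|] /=.
- by rewrite divr_ge0 ?powR_ge0.
- have := norm_p_le_ceil y; have := norm_p_ge0 y; rewrite subr_ge0.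
  move: g0; rewrite le_eqVlt => /predU1P[<-|g0]; first by rewrite invr0 mulr0.
  by rewrite ler_pdivrMr // mul1r.
rewrite (bigD1 None) //= [X in _ + X](reindex_omap Some id) /=; last by case.
rewrite (eq_bigl predT) => [|j]; last by rewrite eqxx.
by rewrite -mulr_suml subrK.
Qed.


Hypotheses (k_gt0 : (0 < k)%N) (B_gt0 : (0 < B)%N) (T_gt0 : 0 < T).
Hypotheses (delta_gt0 : 0 < delta) (delta_le : delta <= 2^-1).

Lemma tau_gt0 s : 0 < tau s.
Proof. by rewrite divr_gt0 ?exprn_gt0. Qed.

Lemma tauS s : tau s.+1 = 2 * tau s.
Proof. by rewrite /tau exprS mulrA. Qed.

Lemma cut_gt0 s : 0 < cut s.
Proof. by rewrite divr_gt0 ?ltr0n // mulr_gt0 ?tau_gt0. Qed.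

(** * Bias and variance of a single copy, for fixed inputs *)

Section Analysis.
Variable y : 'I_k -> inp.

Definition freq j : R := \sum_i (y i j)%:R.
Definition moment : R := \sum_j freq j `^ p.
Definition msgs (w : level_draws) : 'I_k -> level_msg :=
  fun i => level_site_msg (y i) i w.

Definition reveal i s j (z : option 'I_n) : R :=
  weight s j (omap (fun j' => (j', y i j')) z).
Definition copy_estimate s j (d : draws) : R :=
  \sum_i (norm_ceil (y i))%:R / B%:R * \sum_t reveal i s j (d (i, t, y i)).
(** The mean of [copy_estimate]. *)
Definition trunc_freq s j : R := \sum_i (cut s <= (y i j)%:R)%R%:R * (y i j)%:R.

Lemma estimate_msgs w s r j : estimate (msgs w) s r j = copy_estimate s j (w r).
Proof.
apply: eq_bigr => i _ /=; rewrite inordK ?norm_ceil_bound //; congr (_ * _).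
by apply: eq_bigr => t _; rewrite ffunE.
Qed.

(** Only the outcome [Some j] has nonzero weight. The function [f] allows one computation for the
    first and the second moment. *)
Lemma Ex_draw i s j (f : R -> R) : f 0 = 0 ->
  Ex (draw_pr (y i)) (fun z => f (reveal i s j z))
  = (y i j)%:R `^ p / (norm_ceil (y i))%:R *
    f ((cut s <= (y i j)%:R)%R%:R * ((y i j)%:R / (y i j)%:R `^ p)).
Proof.
move=> f0; rewrite /Ex /reveal (bigD1 (Some j)) //= eqxx big1 ?addr0 //.
case=> [j'|] //= nj; last by rewrite f0 mulr0.
have /negbTE-> : j' != j by apply: contra nj => /eqP->.
by rewrite mul0r f0 mulr0.
Qed.

Lemma norm_ceil_gt0 i s j : cut s <= (y i j)%:R ->
  0 < (y i j)%:R `^ p /\ 0 < (norm_ceil (y i))%:R :> R.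
Proof.
move=> cy; have a0 : 0 < (y i j)%:R `^ p :> R.
  by rewrite powR_gt0 // (lt_le_trans (cut_gt0 s)).
split=> //; apply: lt_le_trans (norm_p_le_ceil _).
exact: lt_le_trans (norm_p_coord _ j).
Qed.

Lemma Ex_draw_mean i s j :
  Ex (draw_pr (y i)) (fun z => (norm_ceil (y i))%:R * reveal i s j z)
  = (cut s <= (y i j)%:R)%R%:R * (y i j)%:R.
Proof.
rewrite (Ex_draw i s j (f := fun x => _ * x)) ?mulr0 //.
case: (boolP (cut s <= _)) => [/norm_ceil_gt0[a0 g0]|_]; last by rewrite !mul0r !mulr0.
by rewrite !mul1r; field; rewrite !gt_eqF.
Qed.

(** When the entry passes the cut, the second moment is the normaliser times the entry to the power
    2 - p, which is largest at the cut. *)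
Lemma Ex_draw_sqr i s j :
  Ex (draw_pr (y i)) (fun z => ((norm_ceil (y i))%:R * reveal i s j z) ^+ 2)
  <= 2 * norm_p (y i) * (cut s ^+ 2 / cut s `^ p).
Proof.
rewrite (Ex_draw i s j (f := fun x => (_ * x) ^+ 2)) ?mulr0 ?expr0n //.
have V0 : 0 <= cut s ^+ 2 / cut s `^ p.
  by rewrite divr_ge0 ?powR_ge0 ?sqr_ge0.
case: (boolP (cut s <= _)) => [cy|_]; last first.
  by rewrite mul0r mulr0 expr0n mulr0 mulr_ge0 // mulr_ge0 // norm_p_ge0.
have [a0 g0] := norm_ceil_gt0 cy.
rewrite mul1r [leLHS](_ : _ =
    (norm_ceil (y i))%:R * ((y i j)%:R ^+ 2 / (y i j)%:R `^ p)); last first.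
  by field; rewrite !gt_eqF.
apply: ler_pM.
- exact: ltW.
- by rewrite divr_ge0 ?powR_ge0 // exprn_ge0.
- exact: norm_ceil_le.
by apply: sqr_div_powR_le => //; exact: cut_gt0.
Qed.

Lemma freq_ge0 j : 0 <= freq j.
Proof. exact: sumr_ge0. Qed.

Lemma moment_ge0 : 0 <= moment.
Proof. by apply: sumr_ge0 => *; exact: powR_ge0. Qed.

Lemma sum_norm_p_le : \sum_i norm_p (y i) <= moment.
Proof.
rewrite exchange_big; apply: ler_sum => j _.
exact: sum_powR_le.
Qed.

Lemma trunc_freq_le s j : trunc_freq s j <= freq j.
Proof.
by apply: ler_sum => i _; case: (cut s <= _)%R; rewrite ?mul1r ?mul0r.
Qed.

Lemma trunc_freq_ge s j : freq j - delta * tau s <= trunc_freq s j.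
Proof.
rewrite lerBlDr /trunc_freq.
have -> : delta * tau s = \sum_(i < k) cut s.
  rewrite sumr_const card_ord -mulr_natl /cut; field.
  by rewrite pnatr_eq0 -lt0n.
rewrite -big_split; apply: ler_sum => i _ /=.
case: (leP (cut s) _) => [_|/ltW]; rewrite ?mul1r ?mul0r ?add0r //.
by rewrite lerDl ltW ?cut_gt0.
Qed.

Definition variance_bound s : R := 2 * moment / B%:R * (cut s ^+ 2 / cut s `^ p).

Lemma draws_pr_dist : is_dist draws_pr.
Proof. by apply: prod_pr_dist => key; exact: draw_pr_dist. Qed.

Lemma level_draws_pr_dist : is_dist level_draws_pr.
Proof. by apply: prod_pr_dist => r; exact: draws_pr_dist. Qed.

(** The triples (site, draw, actual input) are distinct keys, so the variances of the [k * B] draws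
    add up; averaging leaves a factor 1 / B, and the local moments sum to at most the global one by
    superadditivity. *)
Lemma copy_estimate_variance s j :
  Ex draws_pr (fun d => (copy_estimate s j d - trunc_freq s j) ^+ 2)
  <= variance_bound s.
Proof.
pose key (it : 'I_k * 'I_B) := (it.1, it.2, y it.1).
pose mu i : R := (cut s <= (y i j)%:R)%R%:R * (y i j)%:R.
pose X (it : 'I_k * 'I_B) z :=
  B%:R^-1 * ((norm_ceil (y it.1))%:R * reveal it.1 s j z - mu it.1).
have B0 : B%:R != 0 :> R by rewrite pnatr_eq0 -lt0n.
have -> : Ex draws_pr (fun d => (copy_estimate s j d - trunc_freq s j) ^+ 2)
    = Ex draws_pr (fun d => (\sum_it X it (d (key it))) ^+ 2).
  apply: eq_Ex => d; congr (_ ^+ 2).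
  rewrite -(pair_bigA _ (fun i t => X (i, t) (d (key (i, t))))).
  rewrite /copy_estimate /trunc_freq -sumrB.
  apply: eq_bigr => i _ /=; rewrite -/(mu i).
  have -> : mu i = \sum_(t < B) B%:R^-1 * mu i.
    by rewrite sumr_const card_ord -[RHS]mulr_natl mulrA mulfV ?mul1r.
  rewrite mulr_sumr -sumrB; apply: eq_bigr => t _.
  by rewrite /X /=; ring.
rewrite (Ex_sqr_sum_coord (D := fun key => draw_pr key.2)) /=; last 3 first.
- by move=> ?; exact: draw_pr_dist.
- by move=> [i t] [i' t'] [-> ->].
- move=> [i t]; rewrite ExZl /= ExD Ex_draw_mean Ex_cst; last exact: draw_pr_dist.
  by rewrite subrr mulr0.
have VB i : Ex (draw_pr (y i)) (fun z =>
      ((norm_ceil (y i))%:R * reveal i s j z - mu i) ^+ 2)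
    <= 2 * norm_p (y i) * (cut s ^+ 2 / cut s `^ p).
  apply: le_trans (Ex_draw_sqr i s j).
  have -> : Ex (draw_pr (y i)) (fun z =>
      ((norm_ceil (y i))%:R * reveal i s j z - mu i) ^+ 2)
    = Ex (draw_pr (y i)) (fun z =>
      ((norm_ceil (y i))%:R * reveal i s j z) ^+ 2) - mu i ^+ 2.
    transitivity (Ex (draw_pr (y i)) (fun z =>
        (((norm_ceil (y i))%:R * reveal i s j z) ^+ 2 +
        (- 2 * mu i) * ((norm_ceil (y i))%:R * reveal i s j z)) + mu i ^+ 2)).
      by apply: eq_Ex => z; ring.
    rewrite !ExD ExZl Ex_draw_mean Ex_cst; last exact: draw_pr_dist.
    by rewrite -/(mu i); ring.
  by rewrite gerBl sqr_ge0.
apply: (@le_trans _ _ (\sum_(it : 'I_k * 'I_B)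
   B%:R^-1 ^+ 2 * (2 * norm_p (y it.1) * (cut s ^+ 2 / cut s `^ p)))).
  apply: ler_sum => -[i t] _ /=.
  under eq_Ex do rewrite /X /= exprMn.
  by rewrite ExZl ler_wpM2l ?sqr_ge0.
rewrite -(pair_bigA _ (fun i (t : 'I_B) =>
   B%:R^-1 ^+ 2 * (2 * norm_p (y i) * (cut s ^+ 2 / cut s `^ p)))) /=.
rewrite (eq_bigr (fun i => norm_p (y i) * (2 / B%:R * (cut s ^+ 2 / cut s `^ p)))).
  rewrite -mulr_suml /variance_bound.
  have V0 : 0 <= 2 / B%:R * (cut s ^+ 2 / cut s `^ p).
    by apply: mulr_ge0; apply: divr_ge0; rewrite ?powR_ge0 ?sqr_ge0.
  apply: le_trans (ler_wpM2r V0 sum_norm_p_le) _.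
  by rewrite [leLHS](_ : _ = 2 * moment / B%:R * (cut s ^+ 2 / cut s `^ p)) //; ring.
move=> i _; rewrite sumr_const card_ord -mulr_natl; field.
by rewrite B0 gt_eqF // powR_gt0 ?cut_gt0.
Qed.

Hypotheses (c_gt0 : (0 < c)%N)
  (B_large : k%:R `^ (p - 2) * (16 * c%:R * T / delta `^ p) <= B%:R).

(* [kappa s] bounds the probability that one copy of the scale-[s] estimate is
   off by [delta * tau s] (Chebyshev). *)
Definition kappa s : R := moment / (8 * c%:R * T * tau s `^ p).

Let c0 : 0 < c%:R :> R. Proof. by rewrite ltr0n. Qed.

Lemma kappa_ge0 s : 0 <= kappa s.
Proof.
rewrite divr_ge0 ?moment_ge0 // mulr_ge0 ?powR_ge0 // mulr_ge0 ?ltW //.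
by rewrite mulr_gt0.
Qed.

(** The source of the sampling rate: the cut contains 1 / k, and its power 2 - p therefore costs k
    to the power p - 2, which [B_large] pays for. *)
Lemma variance_bound_kappa s : variance_bound s <= kappa s * (delta * tau s) ^+ 2.
Proof.
have k0 : 0 < k%:R :> R by rewrite ltr0n.
have B0 : 0 < B%:R :> R by rewrite ltr0n.
have t0 := tau_gt0 s.
have dt0 : 0 < delta * tau s by rewrite mulr_gt0.
have tp0 : 0 < tau s `^ p by rewrite powR_gt0.
have dp0 : 0 < delta `^ p by rewrite powR_gt0.
have kp0 : 0 < k%:R `^ p :> R by rewrite powR_gt0.
have kp2 : k%:R `^ (p - 2) = k%:R `^ p / k%:R ^+ 2 :> R.
  by rewrite -[RHS]invf_div sqr_div_powR // invrK.
have cutp : cut s `^ p = delta `^ p * tau s `^ p / k%:R `^ p.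
  by rewrite /cut !powRM ?powR_inv ?invr_ge0 ?(ltW dt0) // ltW.
rewrite /variance_bound /kappa cutp /cut.
have -> : 2 * moment / B%:R * ((delta * tau s / k%:R) ^+ 2 /
    (delta `^ p * tau s `^ p / k%:R `^ p))
  = 2 * moment * (delta * tau s) ^+ 2 / (delta `^ p * tau s `^ p)
    * (k%:R `^ (p - 2) / B%:R).
  rewrite kp2; field; rewrite !gt_eqF //.
have -> : moment / (8 * c%:R * T * tau s `^ p) * (delta * tau s) ^+ 2
  = 2 * moment * (delta * tau s) ^+ 2 / (delta `^ p * tau s `^ p)
    * (delta `^ p / (16 * c%:R * T)).
  field; rewrite !gt_eqF //.
apply: ler_wpM2l.
  rewrite divr_ge0 //; last by rewrite ltW // mulr_gt0.
  by rewrite mulr_ge0 ?sqr_ge0 // mulr_ge0 // moment_ge0.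
have cT0 : 0 < 16 * c%:R * T by rewrite !mulr_gt0.
rewrite ler_pdivrMr // mulrAC ler_pdivlMr //.
have := B_large; rewrite mulrA ler_pdivrMr //.
by rewrite [_ * B%:R]mulrC.
Qed.

Lemma copy_chebyshev s j :
  Ex draws_pr (fun d => ((copy_estimate s j d - trunc_freq s j) / (delta * tau s)) ^+ 2)
  <= kappa s.
Proof.
under eq_Ex do rewrite exprMn.
have d0 : 0 < delta * tau s by rewrite mulr_gt0 ?tau_gt0.
rewrite ExZr exprVn ler_pdivrMr ?exprn_gt0 //.
exact: le_trans (copy_estimate_variance s j) (variance_bound_kappa s).
Qed.

Definition overestimated s j (w : level_draws) : bool :=
  (tau s <= min_estimate (msgs w) s j)
  && ((1 + delta) * freq j < min_estimate (msgs w) s j).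

(** All [c] independent copies must exceed the threshold, so the Chebyshev bounds multiply. The
    factor 4 appears because the excess is only known to be [delta * tau s / 2]. *)
Lemma overestimated_pr s j :
  Ex level_draws_pr (fun w => (overestimated s j w)%:R) <= (4 * kappa s) ^+ c.
Proof.
have t0 := tau_gt0 s.
pose X d : R := 4 * ((copy_estimate s j d - trunc_freq s j) / (delta * tau s)) ^+ 2.
apply: (@le_trans _ _ (Ex level_draws_pr (fun w => \prod_(r < c) X (w r)))).
  apply: (ler_Ex level_draws_pr_dist) => w.
  case: (boolP (overestimated s j w)) => [/andP[le_t lt_v]|_]; last first.
    by apply: prodr_ge0 => r _; rewrite mulr_ge0 ?sqr_ge0.
  have -> : true%:R = \prod_(r < c) (1 : R) by rewrite big1.
  apply: ler_prod => r _; rewrite ler01 /=.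
  have := bigmin_le (4 * tau s) r (fun r => estimate (msgs w) s r j).
  rewrite -/(min_estimate (msgs w) s j) estimate_msgs => le_r.
  have {}le_t := le_trans le_t le_r.
  have {}lt_v := lt_le_trans lt_v le_r.
  have := trunc_freq_le s j; rewrite /X.
  move: (copy_estimate _ _ _) (trunc_freq _ _) le_t lt_v (freq_ge0 j) => a b ta va v0 bv.
  have d1 : 0 < 1 + delta by move: delta_gt0; lra.
  have d2 : 0 < delta * tau s by rewrite mulr_gt0.
  (* From a > (1 + delta) freq and a >= tau one gets (1 + delta)(a - freq) >= delta tau, and 1 +
     delta <= 2; truncation only lowers the mean below freq. *)
  have ab : delta * tau s / 2 <= a - b.
    have h1 : (1 + delta) * (a - freq j) >= delta * a.
      by move: va; rewrite mulrDl mul1r; lra.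
    have h2 : delta * tau s <= delta * a by rewrite ler_wpM2l // ltW.
    have h3 : (1 + delta) * (a - freq j) <= 2 * (a - freq j).
      apply: ler_wpM2r; last by move: delta_le; lra.
      rewrite subr_ge0; move: va; rewrite mulrDl mul1r.
      have := mulr_ge0 (ltW delta_gt0) v0; lra.
    by lra.
  rewrite (_ : 4 * _ = (2 * (a - b) / (delta * tau s)) ^+ 2); last first.
    by field; rewrite !gt_eqF.
  rewrite -[1](expr1n _ 2) lerXn2r ?nnegrE //.
    by rewrite divr_ge0 ?ltW //; lra.
  by rewrite ler_pdivlMr //; lra.
rewrite (Ex_prod _ (fun _ => X)) prodr_const card_ord lerXn2r ?nnegrE //.
- by apply: (Ex_ge0 draws_pr_dist) => d; rewrite mulr_ge0 ?sqr_ge0.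
- by rewrite mulr_ge0 ?kappa_ge0.
- by rewrite ExZl ler_wpM2l ?copy_chebyshev.
Qed.

(** Union bound over the copies. The tolerance [delta * freq j] is at least [2 * delta * tau s], of
    which the truncation bias uses one half and the deviation the other; the upper bound on [freq j]
    ensures that the cap is not to blame. *)
Lemma underestimated_pr s j : 2 * tau s <= freq j -> freq j < 4 * tau s ->
  Ex level_draws_pr
    (fun w => (min_estimate (msgs w) s j < (1 - delta) * freq j)%R%:R)
  <= c%:R * kappa s.
Proof.
move=> ge2 lt4; have t0 := tau_gt0 s.
pose X d : R := ((copy_estimate s j d - trunc_freq s j) / (delta * tau s)) ^+ 2.
apply: (@le_trans _ _ (Ex level_draws_pr (fun w => \sum_(r < c) X (w r)))).
  apply: (ler_Ex level_draws_pr_dist) => w.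
  case: ltP => [/bigmin_ltP|_]; last by apply: sumr_ge0 => r _; exact: sqr_ge0.
  have dv : 0 <= delta * freq j by rewrite mulr_ge0 ?freq_ge0 // ltW.
  case=> [|[r _]]; first by rewrite mulrBl mul1r; lra.
  rewrite estimate_msgs => lt_r.
  rewrite (bigD1 r) //= ler_wpDr //.
    by apply: sumr_ge0 => r' _; exact: sqr_ge0.
  have d2 : 0 < delta * tau s by rewrite mulr_gt0.
  have := trunc_freq_ge s j; rewrite /X.
  have d3 : delta * (2 * tau s) <= delta * freq j by rewrite ler_wpM2l // ltW.
  move: (copy_estimate _ _ _) (trunc_freq _ _) lt_r => a b ar bv.
  rewrite (_ : (_ / _) ^+ 2 = ((b - a) / (delta * tau s)) ^+ 2); last first.
    by field; rewrite !gt_eqF.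
  rewrite -[1%:R](expr1n _ 2) lerXn2r ?nnegrE //.
    by rewrite divr_ge0 ?ltW //; move: ar; rewrite mulrBl mul1r; lra.
  by rewrite ler_pdivlMr //; move: ar; rewrite mulrBl mul1r; lra.
rewrite Ex_sum; apply: (@le_trans _ _ (\sum_(r < c) kappa s)).
  apply: ler_sum => r _; rewrite Ex_coord; last by move=> ?; exact: draws_pr_dist.
  exact: copy_chebyshev.
by rewrite sumr_const card_ord mulr_natl.
Qed.

Hypotheses (T_ge1 : 1 <= T) (c_ge3 : (3 <= c)%N) (n_le : (n <= 2 ^ (c - 3))%N)
  (N_large : (2 ^+ q + 1) * T <= N%:R) (Sm_large : k%:R * M%:R <= tau Sm).

Let p_ge0 : 0 <= p. Proof. exact: ltW. Qed.

Lemma tau_le s s' : (s <= s')%N -> tau s <= tau s'.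
Proof.
by move=> ss'; rewrite ler_pM2r ?invr_gt0 // ler_weXn2l ?ler1n.
Qed.

Lemma two_powR_le : 2 `^ p <= 2 ^+ q :> R.
Proof. by rewrite powR_le_exprn ?ler1n. Qed.

Lemma four_powR_le : 4 `^ p <= 4 ^+ q :> R.
Proof. by rewrite powR_le_exprn ?ler1n. Qed.

Lemma sum_freq_sqr_le : \sum_j (freq j `^ p) ^+ 2 <= moment ^+ 2.
Proof.
rewrite expr2 /moment mulr_suml; apply: ler_sum => j _.
rewrite expr2 ler_wpM2l ?powR_ge0 // (bigD1 j) //= lerDl sumr_ge0 // => *.
exact: powR_ge0.
Qed.

Lemma freq_powR_le j : freq j `^ p <= moment.
Proof.
by rewrite /moment (bigD1 j) //= lerDl sumr_ge0 // => *; exact: powR_ge0.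
Qed.

Lemma freq_le j : freq j <= tau Sm.
Proof.
apply: le_trans Sm_large; rewrite mulr_natl -[k in _ *+ k]card_ord -sumr_const.
by apply: ler_sum => i _; rewrite ler_nat -ltnS.
Qed.

Lemma geometric_sum_le (s0 m : nat) :
  \sum_(s < m | (s0 <= s)%N) 2^-1 ^+ (s - s0).+1 <= 1 - 2^-1 ^+ (m - s0) :> R.
Proof.
rewrite big_mkcond; elim: m => [|m IH]; first by rewrite big_ord0 sub0n expr0 subrr.
rewrite big_ord_recr /=; case: leqP => [s0m|ms0].
  by rewrite subSn // !exprS in IH *; lra.
by move: IH; rewrite addr0 (eqP (ltnW ms0)) (eqP ms0).
Qed.

(** * Errors relative to a base scale [s0], where T times the power of [tau s0] is comparable to the
    moment *)

Section BaseScale.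
Variable s0 : nat.
Hypotheses (s0_low : moment <= T * tau s0 `^ p)
  (s0_high : T * tau s0 `^ p <= 2 ^+ q * moment).

Lemma tau_powR_grows s : (s0 <= s)%N -> 2 ^+ (s - s0) * tau s0 `^ p <= tau s `^ p.
Proof.
move=> ss; have -> : tau s = 2 ^+ (s - s0) * tau s0.
  by rewrite /tau mulrA -exprD subnK.
rewrite powRM ?(ltW (tau_gt0 s0)) ?exprn_ge0 // ler_wpM2r ?powR_ge0 //.
by rewrite le1r_powR // exprn_ege1 // ler1n.
Qed.

(** At the base scale [4 * kappa s0] is at most 1 / (2 c), and [kappa] at least halves from one
    scale to the next because [tau] doubles and p >= 1. *)
Lemma kappa_decays s : (s0 <= s)%N -> 4 * kappa s <= 2^-1 ^+ (s - s0).+1.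
Proof.
move=> ss; have tp0 : 0 < tau s `^ p by rewrite powR_gt0 ?tau_gt0.
have g0 : 0 < 2 ^+ (s - s0).+1 :> R by rewrite exprn_gt0.
have c1 : 1 <= c%:R :> R by rewrite ler1n.
rewrite /kappa mulrA ler_pdivrMr ?mulr_gt0 // exprVn.
rewrite -(ler_pM2l g0) mulrA mulVKf ?gt_eqF //.
have h1 := tau_powR_grows ss.
have h2 : 2 ^+ (s - s0) * moment <= T * tau s `^ p.
  apply: le_trans (ler_wpM2l _ s0_low) _; first by rewrite exprn_ge0.
  by rewrite mulrCA ler_wpM2l // ltW.
have h3 : T * tau s `^ p <= c%:R * (T * tau s `^ p).
  by rewrite ler_peMl // mulr_ge0 ?powR_ge0 // ltW.
rewrite exprS; move: h2 h3; rewrite [c%:R * (_ * _)]mulrA.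
by rewrite -!mulrA; lra.
Qed.

(** Of the [e.+1] factors, [e] are bounded by 1/2 each and the last one is summed as a geometric
    series. *)
Lemma sum_kappa_le e :
  \sum_(s < Sm | (s0 <= s)%N) (4 * kappa s) ^+ e.+1 <= 2^-1 ^+ e.
Proof.
have half0 : 0 <= 2^-1 :> R by [].
apply: (@le_trans _ _ (\sum_(s < Sm | (s0 <= s)%N) 2^-1 ^+ e * 2^-1 ^+ (s - s0).+1)).
  apply: ler_sum => s ss; rewrite exprSr; have kd := kappa_decays ss.
  have k0 : 0 <= 4 * kappa s by rewrite mulr_ge0 ?kappa_ge0.
  apply: ler_pM => //; first by rewrite exprn_ge0.
  apply: lerXn2r; rewrite ?nnegrE //; apply: le_trans kd _.
  by rewrite exprS ler_piMr // exprn_ile1 // invf_le1 // ler1n.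
rewrite -mulr_sumr ler_piMr ?exprn_ge0 //; apply: le_trans (geometric_sum_le _ _) _.
by rewrite gerBl exprn_ge0.
Qed.

Lemma n_half_le1 e : (c - 3 <= e)%N -> n%:R * 2^-1 ^+ e <= 1 :> R.
Proof.
move=> ce; rewrite exprVn ler_pdivrMr ?exprn_gt0 // mul1r -natrX ler_nat.
by rewrite (leq_trans n_le) // leq_pexp2l.
Qed.

Definition spurious w : R :=
  \sum_j \sum_(s < Sm | (s0 <= s)%N) (overestimated s j w)%:R.

Lemma Ex_spurious : Ex level_draws_pr spurious <= 1.
Proof.
rewrite Ex_sum; apply: (@le_trans _ _ (\sum_(j < n) 2^-1 ^+ (c.-1))).
  apply: ler_sum => j _; rewrite Ex_sum; apply: le_trans (sum_kappa_le c.-1).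
  by apply: ler_sum => s _; rewrite prednK ?overestimated_pr.
rewrite sumr_const card_ord -[leLHS]mulr_natl n_half_le1 //.
by rewrite -subn1 leq_sub2l.
Qed.

Definition crowded w : bool := (N < #|level_set (msgs w) s0|)%N.

(** A member of the level set is either heavy, [tau s0 <= 2 * freq j], which holds for at most
    [2 ^+ q * T] coordinates by [s0_low], or overestimated at some scale from [s0] on. As [N]
    exceeds the first count by [T], crowding forces [spurious] above [T], and its mean is at most
    1. *)
Lemma Ex_crowded : Ex level_draws_pr (fun w => (crowded w)%:R) <= T^-1.
Proof.
apply: (@le_trans _ _ (Ex level_draws_pr (fun w => T^-1 * spurious w))); last first.
  by rewrite ExZl ger_pMr ?invr_gt0 // Ex_spurious.
apply: (ler_Ex level_draws_pr_dist) => w.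
have sp0 : 0 <= spurious w by do 2![apply: sumr_ge0 => ? _].
rewrite mulrC ler_pdivlMr //; case: (boolP (crowded w)) => [|_]; last by rewrite mul0r.
rewrite mul1r /crowded -(ltr_nat R) => lt_card.
have card_le : #|level_set (msgs w) s0|%:R <= 2 ^+ q * T + spurious w.
  rewrite -sum1_card natr_sum big_mkcond /=.
  have bnd j : (if j \in level_set (msgs w) s0 then 1 else 0 : R) <=
     2 ^+ q * T * (freq j `^ p / moment)
     + \sum_(s < Sm | (s0 <= s)%N) (overestimated s j w)%:R.
    have b0 : 0 <= 2 ^+ q * T * (freq j `^ p / moment).
      apply: mulr_ge0; first by rewrite mulr_ge0 ?exprn_ge0 // ltW.
      by rewrite divr_ge0 ?powR_ge0 ?moment_ge0.
    have b1 : 0 <= \sum_(s < Sm | (s0 <= s)%N) ((overestimated s j w)%:R : R).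
      by apply: sumr_ge0.
    rewrite inE; case: existsP => [[s /andP[ss le_s]]|_]; last by rewrite addr_ge0.
    have [le_v|lt_v] := leP (tau s0) (2 * freq j).
      rewrite ler_wpDr //.
      have F0 : 0 < moment.
        apply: lt_le_trans (freq_powR_le j); rewrite powR_gt0 //.
        by have := tau_gt0 s0; lra.
      rewrite mulrA ler_pdivlMr // mul1r (le_trans s0_low) //.
      rewrite -mulrA [leRHS]mulrCA ler_wpM2l //; first exact: ltW.
      apply: le_trans (ler_powR_base p_ge0 _ le_v) _; first by rewrite ltW ?tau_gt0.
      by rewrite powRM ?freq_ge0 // ler_wpM2r ?powR_ge0 // two_powR_le.
    rewrite ler_wpDl // (bigD1 s) //= ler_wpDr //; first by apply: sumr_ge0.
    rewrite /overestimated le_s /=.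
    suff -> : (1 + delta) * freq j < min_estimate (msgs w) s j by [].
    apply: lt_le_trans le_s; apply: lt_le_trans (tau_le ss).
    apply: le_lt_trans lt_v; rewrite ler_wpM2r ?freq_ge0 //.
    by move: delta_le; lra.
  apply: le_trans (ler_sum _ (fun j _ => bnd j)) _.
  rewrite big_split /= -mulr_sumr -mulr_suml lerD2r.
  have [->|F0] := eqVneq moment 0.
    by rewrite invr0 mulr0 mulr0 mulr_ge0 ?exprn_ge0 // ltW.
  by rewrite -/moment mulfV // mulr1.
by move: N_large lt_card card_le; rewrite mulrDl mul1r; lra.
Qed.

(** Take the least scale with [freq j < 4 * tau s]: failure one scale lower gives the other
    inequality, and [freq_le] keeps the index below [Sm]. *)
Lemma scale_of j : 2 * tau s0 <= freq j ->
  exists s : 'I_Sm, [/\ (s0 <= s)%N, 2 * tau s <= freq j & freq j < 4 * tau s].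
Proof.
move=> ge2; pose P s := freq j < 4 * tau s.
have exP : exists s, P s.
  by exists Sm; rewrite /P; have := freq_le j; have := tau_gt0 Sm; lra.
case: (ex_minnP exP) => s Ps min_s.
have s0s : (s0 <= s)%N.
  rewrite leqNgt; apply/negP => ss0.
  have : tau s.+1 <= tau s0 by apply: tau_le.
  by move: Ps; rewrite /P tauS; lra.
have le2 : 2 * tau s <= freq j.
  case: (posnP s) => [s_0|].
    by move: s0s ge2; rewrite s_0 leqn0 => /eqP->.
  case: s Ps min_s s0s => // s Ps min_s s0s _.
  have := contraNN (min_s s); rewrite -ltnNge ltnS leqnn => /(_ isT).
  by rewrite /P -leNgt tauS; lra.
have sSm : (s < Sm)%N.
  rewrite ltnNge; apply/negP => /tau_le.
  by have := freq_le j; have := tau_gt0 s; lra.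
by exists (Ordinal sSm).
Qed.

Lemma level_set_anti m s s' : (s <= s')%N -> level_set m s' \subset level_set m s.
Proof.
move=> ss'; apply/fintype.subsetP => j; rewrite !inE => /existsP[s1 /andP[s1s' hj]].
by apply/existsP; exists s1; rewrite hj (leq_trans ss').
Qed.

(** Level sets are nested, so all those of size at most [N] lie in the one of least index. *)
Lemma card_candidates m : (#|candidates m| <= N)%N.
Proof.
have [-> |[j]] := set_0Vmem (candidates m); first by rewrite cards0.
rewrite inE => /existsP[s /andP[Ps _]].
case: (@arg_minnP _ s (fun s : 'I_Sm => #|level_set m s| <= N)%N val Ps) => s1 Ps1 min1.
apply: leq_trans Ps1; apply: subset_leq_card; apply/fintype.subsetP => j'.
rewrite inE => /existsP[s' /andP[/min1 s1s']].
exact: (fintype.subsetP (level_set_anti m s1s')).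
Qed.

Lemma candidatesP w j (s : 'I_Sm) : (s0 <= s)%N -> ~~ crowded w ->
  tau s <= min_estimate (msgs w) s j -> j \in candidates (msgs w).
Proof.
move=> ss nc le_s; rewrite inE; apply/existsP.
exists (Ordinal (leq_ltn_trans ss (ltn_ord s))) => /=.
rewrite leqNgt nc inE; apply/existsP; exists s; exact/andP.
Qed.

(** Coordinates with [freq j < 2 * tau s0] are given up altogether, since [s0_high] makes their
    power at most [4 ^+ q * (moment / T)]. A heavier one is lost only by crowding or by an
    underestimate at its own scale, and there [kappa s] times the power of [tau s] is moment / (8 c
    T). *)
Lemma miss_event j : exists f : pred level_draws,
  Ex level_draws_pr (fun w => (f w)%:R) * (freq j `^ p) ^+ 2
    <= T^-1 * (freq j `^ p) ^+ 2 + 4 ^+ q * (moment / T) * freq j `^ p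
  /\ forall w, ~~ f w -> j \in candidates (msgs w)
     /\ ((1 - delta) * freq j) `^ p <= power_estimate (msgs w) j.
Proof.
have v0 := freq_ge0 j; have vp0 : 0 <= freq j `^ p by apply: powR_ge0.
have [lt_v|ge_v] := ltP (freq j) (2 * tau s0).
  exists predT; split=> //; rewrite Ex_cst ?mul1r; last exact: level_draws_pr_dist.
  apply: ler_wpDl; first by rewrite mulr_ge0 ?sqr_ge0 // invr_ge0 ltW.
  rewrite expr2 ler_wpM2r // (le_trans (ler_powR_base p_ge0 v0 (ltW lt_v))) //.
  rewrite powRM ?(ltW (tau_gt0 _)) // mulrA ler_pdivlMr //.
  have -> : 4 ^+ q = 2 ^+ q * 2 ^+ q :> R by rewrite -exprMn; congr (_ ^+ _); ring.
  rewrite -!mulrA; apply: ler_pM; rewrite ?powR_ge0 ?two_powR_le //.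
    by rewrite mulr_ge0 ?powR_ge0 // ltW.
  by rewrite mulrC.
have [s [ss ge2 lt4]] := scale_of ge_v; have t0 := tau_gt0 s.
have dv : delta * freq j <= 2^-1 * freq j by rewrite ler_wpM2r.
exists (fun w => crowded w || (min_estimate (msgs w) s j < (1 - delta) * freq j)).
split=> [|w]; last first.
  rewrite negb_or -leNgt => /andP[nc le_m].
  have le_t : tau s <= min_estimate (msgs w) s j.
    by apply: le_trans le_m; rewrite mulrBl mul1r; lra.
  split; first exact: candidatesP le_t.
  apply: le_trans (le_bigmax_cond _ _ le_t).
  by rewrite ler_powR_base // mulrBl mul1r; lra.
apply: (@le_trans _ _ ((T^-1 + c%:R * kappa s) * (freq j `^ p) ^+ 2)).
  rewrite ler_wpM2r ?sqr_ge0 //.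
  apply: le_trans (lerD Ex_crowded (underestimated_pr ge2 lt4)).
  rewrite -ExD; apply: (ler_Ex level_draws_pr_dist) => w.
  by case: (crowded w); case: (_ < _)%R; rewrite /= ?addr0 ?add0r // lerDl.
rewrite mulrDl lerD2l expr2 [leLHS]mulrA ler_wpM2r //.
have tp0 : 0 < tau s `^ p by rewrite powR_gt0.
apply: (@le_trans _ _ (c%:R * kappa s * (4 ^+ q * tau s `^ p))).
  apply: ler_wpM2l; first by rewrite mulr_ge0 ?kappa_ge0.
  apply: (le_trans (ler_powR_base p_ge0 v0 (ltW lt4))).
  by rewrite powRM ?(ltW t0) // ler_wpM2r ?powR_ge0 ?four_powR_le.
rewrite [leLHS](_ : _ = 4 ^+ q * (moment / T) * 8^-1); last first.
  by rewrite /kappa; field; rewrite !gt_eqF.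
apply: ler_piMr; last by rewrite invf_le1 ?ler1n.
apply: mulr_ge0; first exact: exprn_ge0.
by apply: divr_ge0; [exact: moment_ge0|exact: ltW].
Qed.

Lemma Ex_miss_le (f : 'I_n -> pred level_draws) :
  (forall j, Ex level_draws_pr (fun w => (f j w)%:R) * (freq j `^ p) ^+ 2
    <= T^-1 * (freq j `^ p) ^+ 2 + 4 ^+ q * (moment / T) * freq j `^ p) ->
  Ex level_draws_pr (fun w => \sum_j (f j w)%:R * (freq j `^ p) ^+ 2)
  <= (1 + 4 ^+ q) / T * moment ^+ 2.
Proof.
move=> le_f; rewrite Ex_sum.
apply: (@le_trans _ _ (\sum_j
    (T^-1 * (freq j `^ p) ^+ 2 + 4 ^+ q * (moment / T) * freq j `^ p))).
  by apply: ler_sum => j _; rewrite ExZr; exact: le_f.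
rewrite big_split /= -!mulr_sumr -/moment.
have -> : (1 + 4 ^+ q) / T * moment ^+ 2
   = T^-1 * moment ^+ 2 + 4 ^+ q * (moment / T) * moment by ring.
by rewrite lerD2r ler_wpM2l ?sum_freq_sqr_le // invr_ge0 ltW.
Qed.

Lemma miss_events : exists f : 'I_n -> pred level_draws,
  Ex level_draws_pr (fun w => \sum_j (f j w)%:R * (freq j `^ p) ^+ 2)
    <= (1 + 4 ^+ q) / T * moment ^+ 2
  /\ forall j w, ~~ f j w -> j \in candidates (msgs w)
     /\ ((1 - delta) * freq j) `^ p <= power_estimate (msgs w) j.
Proof.
have [f hf] := choice miss_event.
exists f; split=> [|j]; last exact: (hf j).2.
by apply: Ex_miss_le => j; exact: (hf j).1.
Qed.

(** Budget for squared overestimates. Below [s0] the cap makes each of the at most [N] candidates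
    cheap; from [s0] on, only genuine overestimates are charged, again at the cap. *)
Definition overshoot w j : R :=
  (j \in candidates (msgs w))%:R * ((4 * tau s0) `^ p) ^+ 2
  + \sum_(s < Sm | (s0 <= s)%N) (overestimated s j w)%:R * ((4 * tau s) `^ p) ^+ 2.

Lemma overshoot_ge0 w j : 0 <= overshoot w j.
Proof.
by rewrite addr_ge0 ?sumr_ge0 // => *; rewrite mulr_ge0 ?sqr_ge0.
Qed.

Lemma min_estimate_le m s j : min_estimate m s j <= 4 * tau s.
Proof. exact: bigmin_le_id. Qed.

Lemma power_estimate_ge0 m j : 0 <= power_estimate m j.
Proof.
by rewrite /power_estimate; elim/big_ind: _ => [|u x u0 _|s _]; rewrite ?le_max ?u0 ?powR_ge0.
Qed.

Lemma power_estimate_upper w j : j \in candidates (msgs w) ->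
  power_estimate (msgs w) j <= ((1 + delta) * freq j) `^ p
  \/ power_estimate (msgs w) j ^+ 2 <= overshoot w j.
Proof.
move=> jc; have [|gt_v] := leP (power_estimate (msgs w) j) (((1 + delta) * freq j) `^ p).
  by left.
right; have gt0 := le_lt_trans (powR_ge0 _ _) gt_v.
(* The maximum is attained at one scale; what follows depends on whether that scale lies below
   [s0]. *)
have [s le_s def_s] : exists2 s : 'I_Sm, tau s <= min_estimate (msgs w) s j
    & power_estimate (msgs w) j = min_estimate (msgs w) s j `^ p.
  have [s1 Ps1|noP] := pickP (fun s : 'I_Sm => tau s <= min_estimate (msgs w) s j).
    rewrite /power_estimate; have [|s Ps ->] := @eq_bigmax _ _ _ 0 s1
      (fun s : 'I_Sm => tau s <= min_estimate (msgs w) s j)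
      (fun s : 'I_Sm => min_estimate (msgs w) s j `^ p) Ps1.
      by move=> *; exact: powR_ge0.
    by exists s.
  by move: gt0; rewrite /power_estimate big_pred0 // ltxx.
have ts := tau_gt0 s; have m0 := le_trans (ltW ts) le_s.
have sq x : min_estimate (msgs w) s j <= x ->
    power_estimate (msgs w) j ^+ 2 <= (x `^ p) ^+ 2.
  move=> le_x; rewrite def_s lerXn2r ?nnegrE ?powR_ge0 //.
  exact: ler_powR_base.
have [ss|lt_ss] := leqP s0 s; last first.
  rewrite /overshoot jc mul1r ler_wpDr //.
    by rewrite sumr_ge0 // => *; rewrite mulr_ge0 ?sqr_ge0.
  apply: sq; apply: le_trans (min_estimate_le _ _ _) _.
  by rewrite ler_wpM2l // tau_le // ltnW.
apply: ler_wpDl; first by rewrite mulr_ge0 ?sqr_ge0.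
rewrite (bigD1 s) //= ler_wpDr //.
  by rewrite sumr_ge0 // => *; rewrite mulr_ge0 ?sqr_ge0.
have -> : overestimated s j w.
  rewrite /overestimated le_s /= ltNge; apply/negP => le_v.
  by move: gt_v; rewrite def_s ltNge ler_powR_base.
rewrite mul1r; apply: sq; exact: min_estimate_le.
Qed.

(** Both parts have order (moment / T) squared times a count: O(T) candidates in the first, O(1)
    expected overestimates, weighted by their powers, in the second. *)
Lemma Ex_overshoot : N%:R <= (2 ^+ q + 2) * T ->
  Ex level_draws_pr (fun w => \sum_j overshoot w j)
  <= ((2 ^+ q + 3) * 64 ^+ q) / T * moment ^+ 2.
Proof.
move=> N_small; have F0 := moment_ge0.
have T1 : T^-1 <= 1 by rewrite invf_le1.
have FT : (moment / T) ^+ 2 <= moment ^+ 2 / T.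
  rewrite exprMn ler_wpM2l ?sqr_ge0 // expr2 ler_piMr // invr_ge0 ltW //.
have q16 : (4 ^+ q) ^+ 2 = 16 ^+ q :> R by rewrite exprAC; congr (_ ^+ _); ring.
have q4 : (2 ^+ q) ^+ 2 = 4 ^+ q :> R by rewrite exprAC; congr (_ ^+ _); ring.
have q64 : 64 ^+ q = 16 ^+ q * 4 ^+ q :> R by rewrite -exprMn; congr (_ ^+ _); ring.
have pow4 s : ((4 * tau s) `^ p) ^+ 2 <= 16 ^+ q * (tau s `^ p) ^+ 2.
  rewrite powRM ?(ltW (tau_gt0 _)) // exprMn -q16 ler_wpM2r ?sqr_ge0 //.
  by rewrite lerXn2r ?nnegrE ?powR_ge0 ?exprn_ge0 // four_powR_le.
have part1 w : \sum_j (j \in candidates (msgs w))%:R * ((4 * tau s0) `^ p) ^+ 2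
    <= (2 ^+ q + 2) * 64 ^+ q / T * moment ^+ 2.
  have -> : \sum_j (j \in candidates (msgs w))%:R * ((4 * tau s0) `^ p) ^+ 2
      = #|candidates (msgs w)|%:R * ((4 * tau s0) `^ p) ^+ 2.
    rewrite -mulr_suml -natr_sum -sum1_card [in RHS]big_mkcond.
    by congr (_%:R * _); apply: eq_bigr => j _; case: (j \in _).
  have le_N : #|candidates (msgs w)|%:R <= (2 ^+ q + 2) * T.
    by apply: le_trans N_small; rewrite ler_nat card_candidates.
  have le_t : (tau s0 `^ p) ^+ 2 <= 4 ^+ q * (moment / T) ^+ 2.
    rewrite -q4 -exprMn lerXn2r ?nnegrE ?powR_ge0 //.
      by rewrite mulr_ge0 ?exprn_ge0 // divr_ge0 // ltW.
    by rewrite mulrA ler_pdivlMr // mulrC.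
  apply: (@le_trans _ _ ((2 ^+ q + 2) * T * (16 ^+ q * (4 ^+ q * (moment / T) ^+ 2)))).
    apply: ler_pM => //; rewrite ?sqr_ge0 //.
    by apply: le_trans (pow4 _) _; rewrite ler_wpM2l ?exprn_ge0.
  rewrite q64; apply: ler_of_eq; field; exact: lt0r_neq0.
have part2 : Ex level_draws_pr (fun w => \sum_j \sum_(s < Sm | (s0 <= s)%N)
    (overestimated s j w)%:R * ((4 * tau s) `^ p) ^+ 2) <= 64 ^+ q / T * moment ^+ 2.
  rewrite Ex_sum; apply: (@le_trans _ _ (\sum_(j < n)
      16 ^+ q * (moment / T) ^+ 2 * 2^-1 ^+ (c - 3))).
    apply: ler_sum => j _; rewrite Ex_sum.
    apply: le_trans (ler_wpM2l _ (sum_kappa_le (c - 3))); last first.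
      by rewrite mulr_ge0 ?sqr_ge0 ?exprn_ge0.
    rewrite mulr_sumr; apply: ler_sum => s _; rewrite ExZr.
    apply: le_trans (ler_pM _ _ (overestimated_pr s j) (pow4 s)) _.
    - by apply: (Ex_ge0 level_draws_pr_dist).
    - exact: sqr_ge0.
    (* Two factors pay for the squared power of [tau s], one for the sum over the scales, and
       [c - 3] for the sum over the [n] coordinates. *)
    have -> : (4 * kappa s) ^+ c = (4 * kappa s) ^+ (c - 3).+1 * (4 * kappa s) ^+ 2.
      by rewrite -exprD; congr (_ ^+ _); rewrite addn2 -addn3 subnK.
    have ts : 0 < tau s `^ p by rewrite powR_gt0 ?tau_gt0.
    have kt : 4 * kappa s * tau s `^ p <= moment / T.
      rewrite [leLHS](_ : _ = moment / T * (2 * c%:R)^-1); last first.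
        by rewrite /kappa; field; rewrite !gt_eqF.
      rewrite ler_piMr ?divr_ge0 //; first exact: ltW.
      by rewrite invf_le1 ?mulr_gt0 // -natrM ler1n muln_gt0.
    have kt2 : (4 * kappa s) ^+ 2 * (tau s `^ p) ^+ 2 <= (moment / T) ^+ 2.
      rewrite -exprMn lerXn2r ?nnegrE //.
        by rewrite mulr_ge0 ?powR_ge0 // mulr_ge0 ?kappa_ge0.
      by apply: divr_ge0 => //; exact: ltW.
    have e0 : 0 <= (4 * kappa s) ^+ (c - 3).+1 * 16 ^+ q.
      by rewrite mulr_ge0 ?exprn_ge0 // mulr_ge0 ?kappa_ge0.
    have := ler_wpM2l e0 kt2.
    by rewrite [X in X <= _](_ : _ = (4 * kappa s) ^+ (c - 3).+1 * (4 * kappa s) ^+ 2 *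
      (16 ^+ q * (tau s `^ p) ^+ 2)) ?[X in _ <= X -> _](_ : _ =
      16 ^+ q * (moment / T) ^+ 2 * (4 * kappa s) ^+ (c - 3).+1) //; ring.
  rewrite sumr_const card_ord -[leLHS]mulr_natl mulrCA.
  apply: (@le_trans _ _ (16 ^+ q * (moment / T) ^+ 2)).
    by apply: ler_piMr; [rewrite mulr_ge0 ?sqr_ge0 ?exprn_ge0|exact: n_half_le1].
  rewrite [leRHS]mulrAC -[leRHS]mulrA.
  apply: (@le_trans _ _ (64 ^+ q * (moment / T) ^+ 2)).
    apply: ler_wpM2r; first exact: sqr_ge0.
    by rewrite q64 ler_peMr ?exprn_ge0 // exprn_ege1 // ler1n.
  by apply: ler_wpM2l; first exact: exprn_ge0.
rewrite /overshoot; under eq_Ex do rewrite big_split /=.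
rewrite ExD; apply: le_trans (lerD (ler_Ex level_draws_pr_dist part1) part2) _.
rewrite Ex_cst; last exact: level_draws_pr_dist.
by apply: ler_of_eq; ring.
Qed.

(** A converse of Bernoulli's inequality for integer exponents, by induction with delta squared at
    most delta; [p] is then replaced by [q]. *)
Lemma powR_1D_le : (1 + delta) `^ p <= 1 + 2 ^+ q * delta.
Proof.
have d0 := delta_gt0; have d1 := delta_le.
have bern e : (1 + delta) ^+ e <= 1 + (2 ^+ e - 1) * delta.
  elim: e => [|e IH]; first by rewrite !expr0 subrr mul0r addr0.
  rewrite !exprSr; apply: le_trans (ler_wpM2r _ IH) _; first by lra.
  have g1 : 1 <= 2 ^+ e :> R by rewrite exprn_ege1 // ler1n.
  have dd : (2 ^+ e - 1) * delta * delta <= (2 ^+ e - 1) * delta.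
    by rewrite ler_piMr ?mulr_ge0 ?subr_ge0 //; lra.
  by lra.
apply: le_trans (powR_le_exprn _ p_le_q) _; first by lra.
by apply: le_trans (bern q) _; lra.
Qed.

Lemma powR_1B_ge : 1 - 2 ^+ q * delta <= (1 - delta) `^ p.
Proof.
have d0 := delta_gt0; have d1 := delta_le.
have bern e : 1 - (2 ^+ e - 1) * delta <= (1 - delta) ^+ e.
  elim: e => [|e IH]; first by rewrite !expr0 subrr mul0r subr0.
  rewrite !exprSr; apply: le_trans (ler_wpM2r _ IH); last by lra.
  have g1 : 1 <= 2 ^+ e :> R by rewrite exprn_ege1 // ler1n.
  have dd : 0 <= (2 ^+ e - 1) * delta * delta.
    by rewrite !mulr_ge0 ?subr_ge0 //; lra.
  have d2 : 0 <= (2 ^+ e - 1) * delta by rewrite mulr_ge0 ?subr_ge0 //; lra.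
  by lra.
apply: le_trans (le_trans _ (bern q)) _; first by lra.
have d2 : 0 <= 1 - delta by lra.
(* The base is at most 1, so raising the exponent from [p] to [q] lowers the power. *)
rewrite -powR_mulrn //; apply: ger_powR => //.
by apply/andP; split; lra.
Qed.

(** The three terms pay for misses, for the relative error of the factors 1 - delta and 1 + delta,
    and for overestimates. On [f] an underestimate loses at most the whole power. *)
Lemma estimate_error_le w j (f : bool) :
  (~~ f -> j \in candidates (msgs w)
     /\ ((1 - delta) * freq j) `^ p <= power_estimate (msgs w) j) ->
  ((j \in candidates (msgs w))%:R * power_estimate (msgs w) j - freq j `^ p) ^+ 2
  <= f%:R * (freq j `^ p) ^+ 2 + 4 ^+ q * delta ^+ 2 * (freq j `^ p) ^+ 2
     + overshoot w j.
Proof.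
move=> hf; have o0 := overshoot_ge0 w j.
have v0 := freq_ge0 j; have vp0 : 0 <= freq j `^ p by exact: powR_ge0.
have d0 := delta_gt0; have d1 := delta_le.
have u0 := power_estimate_ge0 (msgs w) j.
have q4 : 4 ^+ q = 2 ^+ q * 2 ^+ q :> R by rewrite -exprMn; congr (_ ^+ _); ring.
set e := 2 ^+ q * delta * freq j `^ p.
have e0 : 0 <= e by rewrite !mulr_ge0 ?exprn_ge0 // ltW.
rewrite (_ : _ * delta ^+ 2 * _ = e ^+ 2); last by rewrite /e q4; ring.
have [jc|jc] := boolP (j \in candidates (msgs w)); last first.
  have -> : f by apply/negP => /negP /hf []; rewrite (negbTE jc).
  by rewrite mul0r sub0r sqrrN mul1r -addrA lerDl addr_ge0 ?sqr_ge0.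
rewrite mul1r; have [le_u|le_u] := power_estimate_upper jc; last first.
  have [le_v|lt_v] := leP (freq j `^ p) (power_estimate (msgs w) j).
    apply: ler_wpDl; first by rewrite addr_ge0 ?sqr_ge0 // mulr_ge0 ?sqr_ge0.
    apply: le_trans le_u; rewrite lerXn2r ?nnegrE ?subr_ge0 //.
    by rewrite gerBl.
  apply: ler_wpDr => //; case: f hf => hf.
    rewrite mul1r; apply: ler_wpDr; first exact: sqr_ge0.
    rewrite -sqrrN opprB lerXn2r ?nnegrE ?subr_ge0 ?(ltW lt_v) //.
    by rewrite gerBl.
  have [_] := hf isT; rewrite powRM ?subr_ge0 //; last by lra.
  move=> ge_u; rewrite mul0r add0r -sqrrN opprB lerXn2r ?nnegrE ?subr_ge0 ?(ltW lt_v) //.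
  have := le_trans (ler_wpM2r vp0 powR_1B_ge) ge_u.
  by rewrite mulrBl mul1r -/e; lra.
have {}le_u : power_estimate (msgs w) j <= freq j `^ p + e.
  apply: le_trans le_u _; rewrite powRM //; last by lra.
  by have := ler_wpM2r vp0 powR_1D_le; rewrite mulrDl mul1r.
apply: ler_wpDr => //; move: u0 le_u hf; set u := power_estimate _ _ => u0 le_u hf.
case: f hf => hf.
  rewrite mul1r; have [le_v|lt_v] := leP (freq j `^ p) u.
    apply: ler_wpDl; first exact: sqr_ge0.
    by rewrite lerXn2r ?nnegrE ?subr_ge0 // lerBlDl.
  apply: ler_wpDr; first exact: sqr_ge0.
  rewrite -sqrrN opprB lerXn2r ?nnegrE ?subr_ge0 ?(ltW lt_v) //.
  by rewrite gerBl.
have [_] := hf isT; rewrite powRM ?subr_ge0 //; last by lra.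
move=> ge_u; have := le_trans (ler_wpM2r vp0 powR_1B_ge) ge_u.
rewrite mulrBl mul1r -/e mul0r add0r => ge_u'.
by rewrite -(real_normK (num_real (u - _))) lerXn2r ?nnegrE // ler_norml; lra.
Qed.

(** Dominates the combined constants of misses and overshoots in front of 1 / T and the factor
    [4 ^+ q] in front of [delta ^+ 2]. *)
Definition level_const : R := (2 ^+ q + 5) * 64 ^+ q.

Lemma level_const_split :
  1 + 4 ^+ q + (2 ^+ q + 3) * 64 ^+ q <= level_const /\ 4 ^+ q <= level_const.
Proof.
have h1 : 1 <= 64 ^+ q :> R by rewrite exprn_ege1 // ler1n.
have h2 : 4 ^+ q <= 64 ^+ q :> R by rewrite lerXn2r ?nnegrE // ler_nat.
have h3 : 0 <= 2 ^+ q * 64 ^+ q :> R by rewrite mulr_ge0 ?exprn_ge0.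
by rewrite /level_const !mulrDl; split; lra.
Qed.

Lemma Ex_estimate_error_scaled : N%:R <= (2 ^+ q + 2) * T ->
  Ex level_draws_pr (fun w => \sum_j
    ((j \in candidates (msgs w))%:R * power_estimate (msgs w) j - freq j `^ p) ^+ 2)
  <= level_const * (T^-1 + delta ^+ 2) * moment ^+ 2.
Proof.
move=> N_small; have [f [Ef hf]] := miss_events.
have [K1 K2] := level_const_split; have F0 := sqr_ge0 moment.
apply: (@le_trans _ _ (Ex level_draws_pr (fun w =>
   \sum_j (f j w)%:R * (freq j `^ p) ^+ 2
   + 4 ^+ q * delta ^+ 2 * moment ^+ 2 + \sum_j overshoot w j))).
  apply: (ler_Ex level_draws_pr_dist) => w.
  apply: (@le_trans _ _ (\sum_j ((f j w)%:R * (freq j `^ p) ^+ 2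
     + 4 ^+ q * delta ^+ 2 * (freq j `^ p) ^+ 2 + overshoot w j))).
    by apply: ler_sum => j _; exact: estimate_error_le (hf j w).
  rewrite !big_split /= -mulr_sumr lerD2r lerD2l ler_wpM2l ?sum_freq_sqr_le //.
  by rewrite mulr_ge0 ?sqr_ge0 ?exprn_ge0.
rewrite !ExD Ex_cst; last exact: level_draws_pr_dist.
have Eo := Ex_overshoot N_small.
apply: le_trans (lerD (lerD Ef (lexx _)) Eo) _.
rewrite [leLHS](_ : _ = (1 + 4 ^+ q + (2 ^+ q + 3) * 64 ^+ q) * (T^-1 * moment ^+ 2)
  + 4 ^+ q * (delta ^+ 2 * moment ^+ 2)); last by ring.
rewrite [leRHS](_ : _ = level_const * (T^-1 * moment ^+ 2)
  + level_const * (delta ^+ 2 * moment ^+ 2)); last by ring.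
apply: lerD; apply: ler_wpM2r => //; rewrite mulr_ge0 ?sqr_ge0 //.
by rewrite invr_ge0 ltW.
Qed.

(** With exact values only missed coordinates err. No [delta ^+ 2] appears, which is why two rounds
    can afford a constant [delta]. *)
Lemma Ex_candidates_error_scaled :
  Ex level_draws_pr (fun w => \sum_j
    ((j \in candidates (msgs w))%:R * freq j `^ p - freq j `^ p) ^+ 2)
  <= level_const / T * moment ^+ 2.
Proof.
have [f [Ef hf]] := miss_events; have [K1 _] := level_const_split.
apply: (@le_trans _ _ (Ex level_draws_pr (fun w =>
    \sum_j (f j w)%:R * (freq j `^ p) ^+ 2))).
  apply: (ler_Ex level_draws_pr_dist) => w; apply: ler_sum => j _.
  have [jc|jc] := boolP (j \in candidates (msgs w)).
    by rewrite mul1r subrr expr0n mulr_ge0 ?sqr_ge0.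
  have -> : f j w by apply/negP => /negP /hf []; rewrite (negbTE jc).
  by rewrite mul0r sub0r sqrrN mul1r.
apply: le_trans Ef _; apply: ler_wpM2r; first exact: sqr_ge0.
apply: ler_wpM2r; first by rewrite invr_ge0 ltW.
by apply: le_trans K1; rewrite lerDl mulr_ge0 ?exprn_ge0.
Qed.

End BaseScale.

(** Take the least scale satisfying the first inequality: its failure one scale lower gives the
    second, as a scale costs a factor at most [2 ^+ q]. At scale 0 the left side of the second is at
    most 1. *)
Lemma base_scale_exists : 1 <= moment -> exists s0,
  moment <= T * tau s0 `^ p /\ T * tau s0 `^ p <= 2 ^+ q * moment.
Proof.
move=> F1; pose P s := moment <= T * tau s `^ p.
have exP : exists s, P s.
  have [m [Fm Tm]] : exists m, moment <= 2 ^+ m /\ T <= 2 ^+ m.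
    exists (maxn (Num.truncn moment).+1 (Num.truncn T).+1).
    have le2 e m : (e <= m)%N -> e%:R <= 2 ^+ m :> R.
      by move=> em; rewrite -natrX ler_nat (leq_trans em) // ltnW // ltn_expl.
    split; [apply: le_trans (ltW (truncnS_gt moment)) _ |
            apply: le_trans (ltW (truncnS_gt T)) _]; apply: le2.
      exact: leq_maxl.
    exact: leq_maxr.
  exists m; rewrite /P.
  have t1 : 1 <= tau m by rewrite /tau ler_pdivlMr // mul1r.
  apply: (@le_trans _ _ (T * tau m)).
    by rewrite /tau mulrC divfK ?gt_eqF.
  by rewrite ler_wpM2l ?le1r_powR // ltW.
case: (ex_minnP exP) => s Ps min_s; exists s; split=> //.
case: s Ps min_s => [|s] Ps min_s.
  have i1 : T^-1 <= 1 by rewrite invf_le1.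
  have i0 : 0 < T^-1 by rewrite invr_gt0.
  apply: (@le_trans _ _ 1).
    rewrite /tau expr0 div1r mulrC -ler_pdivlMr // div1r.
    by rewrite ge1r_powR // i0.
  have q1 : 1 <= 2 ^+ q :> R by rewrite exprn_ege1 // ler1n.
  by apply: le_trans F1 _; rewrite ler_peMl ?moment_ge0.
have : ~~ P s by apply: contraTN (ltnSn s) => /min_s; rewrite ltnNge => ->.
rewrite /P -ltNge tauS powRM ?(ltW (tau_gt0 _)) // => lt_F.
rewrite mulrCA; apply: ler_pM; rewrite ?powR_ge0 ?two_powR_le ?(ltW lt_F) //.
by rewrite mulr_ge0 ?powR_ge0 // ltW.
Qed.

Lemma moment_0_or_ge1 : moment = 0 \/ 1 <= moment.
Proof.
have [j vj0|v0] := pickP (fun j => (0 < \sum_i (y i j))%N).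
  right; apply: le_trans (freq_powR_le j); rewrite /freq -natr_sum.
  apply: (@le_trans _ _ (1 `^ p)); first by rewrite powR1.
  by apply: ler_powR_base; rewrite ?ler1n.
left; apply: big1 => j _; rewrite /freq -natr_sum.
by have := v0 j; rewrite lt0n => /negbFE/eqP->; rewrite powR0 // gt_eqF.
Qed.

(** The case without a base scale: all entries are zero, hence below the cut, and no estimate
    reaches its threshold. *)
Lemma moment0_power_estimate w j : moment = 0 ->
  freq j `^ p = 0 /\ power_estimate (msgs w) j = 0.
Proof.
move=> F0; have vp0 : freq j `^ p = 0.
  by apply/eqP; rewrite eq_le powR_ge0 -F0 freq_powR_le.
split=> //; rewrite /power_estimate big_pred0 // => s; apply/negbTE.
rewrite -ltNge; apply: le_lt_trans (tau_gt0 s).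
(* One copy is needed here to bring the minimum below its default value. *)
rewrite /min_estimate; apply: le_trans (bigmin_le _ (Ordinal c_gt0) _) _.
rewrite estimate_msgs /copy_estimate big1 // => i _.
rewrite big1 ?mulr0 // => t _; rewrite /reveal; case: (w _ _) => //= j'.
case: eqP => [->|]; last by rewrite mul0r.
have -> : (cut s <= (y i j)%:R) = false.
  apply/negbTE; rewrite -ltNge (_ : (y i j)%:R = 0) ?cut_gt0 //.
  apply/eqP; rewrite eq_le ler0n andbT.
  have /powR_eq0_eq0 <- := vp0.
  by rewrite /freq (bigD1 i) //= lerDl sumr_ge0.
by rewrite mul0r.
Qed.

Lemma Ex_estimate_error : N%:R <= (2 ^+ q + 2) * T ->
  Ex level_draws_pr (fun w => \sum_j
    ((j \in candidates (msgs w))%:R * power_estimate (msgs w) j - freq j `^ p) ^+ 2)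
  <= level_const * (T^-1 + delta ^+ 2) * moment ^+ 2.
Proof.
move=> N_small; have [F0|/base_scale_exists[s0 [lo hi]]] := moment_0_or_ge1.
  rewrite F0 expr0n mulr0 /Ex big1 // => w _; rewrite big1 ?mulr0 // => j _.
  by have [-> ->] := moment0_power_estimate w j F0; rewrite mulr0 subrr expr0n.
exact: (Ex_estimate_error_scaled lo hi).
Qed.

Lemma Ex_candidates_error :
  Ex level_draws_pr (fun w => \sum_j
    ((j \in candidates (msgs w))%:R * freq j `^ p - freq j `^ p) ^+ 2)
  <= level_const / T * moment ^+ 2.
Proof.
have [F0|/base_scale_exists[s0 [lo hi]]] := moment_0_or_ge1.
  rewrite F0 expr0n mulr0 /Ex big1 // => w _; rewrite big1 ?mulr0 // => j _.
  by have [-> _] := moment0_power_estimate w j F0; rewrite mulr0 subrr expr0n.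
exact: (Ex_candidates_error_scaled lo hi).
Qed.

End Analysis.
End Level.

(** * The protocols and their parameters *)

Section Protocols.
Variables (R : realType) (n k M c B N Sm q L bb : nat) (p delta T beta eps : R).

Definition restrict (x : 'rV[nat]_n) (S : {set 'I_n}) : inp n M :=
  [ffun j => inord (if j \in S then x 0 j else 0%N)].

Local Notation coins := (masks n L * {ffun 'I_L -> level_draws n k M c B})%type.

Definition coins_pr : coins -> R :=
  pair_pr (@mask_pr R n L) (prod_pr (fun=> level_draws_pr p)).

Definition uplink : finType := {ffun 'I_L -> level_msg n M c B q}.

Definition send (w : coins) (i : 'I_k) (x : 'rV[nat]_n) : uplink :=
  [ffun l : 'I_L => level_site_msg q p (restrict x (survivors w.1 l)) i (w.2 l)].

Definition candidate_set (us : {ffun 'I_k -> uplink}) (l : 'I_L) : {set 'I_n} :=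
  candidates N Sm p delta T (fun i => us i l).

Definition estimate_output (w : coins) (us : {ffun 'I_k -> uplink}) : R :=
  \sum_(l < L) 2 ^+ l * \sum_j sgn R w.1 l j *
    ((j \in candidate_set us l)%:R * power_estimate Sm p delta T (fun i => us i l) j).

Definition queries : finType := {ffun 'I_L * 'I_N -> option 'I_n}.
Definition answers : finType := {ffun 'I_L * 'I_N -> 'I_M.+1}.

Definition ask (us : {ffun 'I_k -> uplink}) : queries :=
  [ffun lc : 'I_L * 'I_N =>
     nth None [seq Some j | j <- enum (candidate_set us lc.1)] lc.2].

Definition answer (w : coins) (i : 'I_k) (x : 'rV[nat]_n) (qs : queries) : answers :=
  [ffun lc : 'I_L * 'I_N =>
     if qs lc is Some j then restrict x (survivors w.1 lc.1) j else ord0].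

(** The slot of [j] is its rank among the candidates, which the coordinator recomputes from the
    first round; [card_candidates] guarantees that the slot exists. *)
Definition collected (us : {ffun 'I_k -> uplink}) (vs : {ffun 'I_k -> answers})
    (l : 'I_L) (j : 'I_n) : R :=
  if insub (index j (enum (candidate_set us l))) is Some r then
    \sum_i (vs i (l, r))%:R
  else 0.

Definition exact_output (w : coins) (us : {ffun 'I_k -> uplink})
    (vs : {ffun 'I_k -> answers}) : R :=
  \sum_(l < L) 2 ^+ l * \sum_j sgn R w.1 l j *
    ((j \in candidate_set us l)%:R * collected us vs l j `^ p).

Hypotheses (p_ge2 : 2 <= p) (p_le_q : p <= q%:R) (k_gt0 : (0 < k)%N).
Hypotheses (B_gt0 : (0 < B)%N) (T_ge1 : 1 <= T) (delta_gt0 : 0 < delta)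
  (delta_le : delta <= 2^-1) (c_ge3 : (3 <= c)%N) (n_le : (n <= 2 ^ (c - 3))%N)
  (B_large : k%:R `^ (p - 2) * (16 * c%:R * T / delta `^ p) <= B%:R)
  (N_large : (2 ^+ q + 1) * T <= N%:R) (N_small : N%:R <= (2 ^+ q + 2) * T)
  (Sm_large : k%:R * M%:R <= tau T Sm).
Hypotheses (eps_gt0 : 0 < eps) (beta_ge0 : 0 <= beta)
  (pr_ge : 2 / 3 <= 1 - n%:R * 2^-1 ^+ L - L%:R * beta / eps).
Hypotheses (bb_G : ((n * M ^ q).+1 <= 2 ^ bb)%N) (bb_draw : ((n * M.+1).+1 <= 2 ^ bb)%N).

Let T_gt0 : 0 < T. Proof. exact: lt_le_trans T_ge1. Qed.
Let c_gt0 : (0 < c)%N. Proof. exact: leq_trans c_ge3. Qed.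
Let p_gt0 : 0 < p. Proof. exact: lt_le_trans p_ge2. Qed.

Lemma coins_pr_dist : is_dist coins_pr.
Proof.
apply: pair_pr_dist; first exact: mask_pr_dist.
by apply: prod_pr_dist => l; exact: level_draws_pr_dist.
Qed.

Section Input.
Variable x : 'I_k -> 'rV[nat]_n.
Hypothesis x_bounded : bounded_inputs M x.

Definition target (j : 'I_n) : R := ((\sum_i x i) 0 j)%R%:R `^ p.

Lemma target_ge0 j : 0 <= target j.
Proof. exact: powR_ge0. Qed.

Lemma restrict_freq S j :
  freq R (fun i => restrict (x i) S) j `^ p = (j \in S)%:R * target j.
Proof.
rewrite /target summxE
  (_ : (\sum_i x i 0 j)%R%:R = \sum_i (x i 0 j)%R%:R :> R); last first.
  exact: (natr_sum R).
case: (boolP (j \in S)) => jS.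
  rewrite mul1r; congr (_ `^ _); apply: eq_bigr => i _.
  by rewrite ffunE jS inordK // ltnS x_bounded.
rewrite mul0r /freq big1 ?powR0 ?gt_eqF // => i _.
by rewrite ffunE (negbTE jS) inordK.
Qed.

Lemma restrict_moment S :
  moment p (fun i => restrict (x i) S) = \sum_j (j \in S)%:R * target j.
Proof. by apply: eq_bigr => j _; exact: restrict_freq. Qed.

Lemma approximation_pr (g : {set 'I_n} -> level_draws n k M c B -> 'I_n -> R) :
  (forall S, Ex (level_draws_pr p)
      (fun w => \sum_j (g S w j - (j \in S)%:R * target j) ^+ 2)
    <= (beta * \sum_j (j \in S)%:R * target j) ^+ 2) ->
  2 / 3 <= \sum_(w | `|subsampled_sum g w.1 w.2 - Fp p (\sum_i x i)|
      <= eps * Fp p (\sum_i x i)) coins_pr w.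
Proof.
move=> g_err; apply: le_trans pr_ge _.
have := subsampled_sum_pr L (level_draws_pr_dist n k M c B p) target_ge0
  beta_ge0 g_err eps_gt0.
move=> h; apply: le_trans h _; rewrite /Ex [leRHS]big_mkcond; apply: ler_sum => w _.
change (\sum_j target j) with (Fp p (\sum_i x i)).
by case: ifP => _; rewrite ?mulr1 ?mulr0.
Qed.

End Input.

Lemma leq_exp2r_weak (a b e : nat) : (a <= b)%N -> (a ^ e <= b ^ e)%N.
Proof. by case: e => // e; rewrite leq_exp2r. Qed.

Lemma card_level_msg : (#|level_msg n M c B q| <= 2 ^ (bb * (1 + c * B)))%N.
Proof.
rewrite card_prod card_ffun card_option !card_prod !card_ord.
rewrite mulnDr muln1 expnD (expnM 2 bb); apply: leq_mul => //.
exact: leq_exp2r_weak.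
Qed.

Lemma card_uplink : (#|uplink| <= 2 ^ (bb * (1 + c * B) * L))%N.
Proof. by rewrite card_ffun card_ord expnM leq_exp2r_weak // card_level_msg. Qed.

Lemma card_queries : (0 < n)%N -> (#|queries| <= 2 ^ (bb * (L * N)))%N.
Proof.
move=> n0; rewrite card_ffun card_option card_prod !card_ord (expnM 2 bb) leq_exp2r_weak //.
by apply: leq_trans bb_draw; rewrite ltnS leq_pmulr.
Qed.

Lemma card_answers : (0 < n)%N -> (#|answers| <= 2 ^ (bb * (L * N)))%N.
Proof.
move=> n0; rewrite card_ffun card_prod !card_ord (expnM 2 bb) leq_exp2r_weak //.
by apply: leq_trans bb_draw; rewrite leqW // leq_pmull.
Qed.

Let uplink0 : uplink := [ffun=> (ord0, [ffun=> None])].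

Lemma one_round_exists :
  level_const R q * (T^-1 + delta ^+ 2) <= beta ^+ 2 ->
  exists P : protocol R k 'rV[nat]_n,
    [/\ rounds P = 1%N, approximates_Fp P M p eps &
      forall (w : coin P) x, comm_cost w x = (k * (bb * (1 + c * B) * L))%N].
Proof.
move=> beta_large.
exists (one_round coins_pr_dist uplink0 (bb * (1 + c * B) * L) send estimate_output).
split=> // [x x_bounded|w x]; last exact: one_round_cost.
(* The estimates of a level depend on the masks only through its survivors, as [subsampled_sum_pr]
   requires. *)
pose g (S : {set 'I_n}) (w : level_draws n k M c B) j : R :=
  (j \in candidates N Sm p delta T (msgs q p (fun i => restrict (x i) S) w))%:R
  * power_estimate Sm p delta T (msgs q p (fun i => restrict (x i) S) w) j.
have g_err S : Ex (level_draws_pr p)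
      (fun w => \sum_j (g S w j - (j \in S)%:R * target x j) ^+ 2)
    <= (beta * \sum_j (j \in S)%:R * target x j) ^+ 2.
  have := Ex_estimate_error p_ge2 p_le_q k_gt0 B_gt0 T_gt0 delta_gt0 delta_le
     (fun i => restrict (x i) S) c_gt0 B_large T_ge1 c_ge3 n_le N_large Sm_large N_small.
  under eq_Ex do under eq_bigr do rewrite (restrict_freq x_bounded).
  rewrite (restrict_moment x_bounded) => /le_trans; apply.
  by rewrite exprMn ler_wpM2r ?sqr_ge0.
have res (w : coins) : estimate_output w [ffun i => send w i (x i)]
    = subsampled_sum g w.1 w.2.
  apply: eq_bigr => l _; congr (_ * _).
  apply: eq_bigr => j _; congr (_ * _); rewrite /g /candidate_set.
  have -> // : (fun i => [ffun i => send w i (x i)] i l)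
    = msgs q p (fun i => restrict (x i) (survivors w.1 l)) (w.2 l).
  by apply/funext => i; rewrite !ffunE.
rewrite (eq_bigl (fun w : coins => `|subsampled_sum g w.1 w.2 - Fp p (\sum_i x i)|
    <= eps * Fp p (\sum_i x i))); first exact: approximation_pr.
by move=> w; rewrite one_round_result ?card_uplink // res.
Qed.

Let answers0 : answers := [ffun=> ord0].
Let queries0 : queries := [ffun=> None].

Lemma collectedE x (w : coins) (us : {ffun 'I_k -> uplink}) l j :
  j \in candidate_set us l ->
  collected us [ffun i => answer w i (x i) (ask us)] l j
  = freq R (fun i => restrict (x i) (survivors w.1 l)) j.
Proof.
move=> jc; have lt_N : (index j (enum (candidate_set us l)) < N)%N.
  apply: leq_trans (card_candidates N Sm p delta T (fun i => us i l)).
  by rewrite cardE index_mem mem_enum.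
rewrite /collected insubT /=. apply: eq_bigr => i _; rewrite !ffunE /=.
rewrite (nth_map j) /=; last by rewrite index_mem mem_enum.
by rewrite nth_index ?mem_enum // ffunE.
Qed.

Lemma two_round_exists : (0 < n)%N -> level_const R q / T <= beta ^+ 2 ->
  exists P : protocol R k 'rV[nat]_n,
    [/\ rounds P = 2%N, approximates_Fp P M p eps &
      forall (w : coin P) x, comm_cost w x
        = (k * (bb * (1 + c * B) * L + bb * (L * N) + bb * (L * N)))%N].
Proof.
move=> n0 beta_large.
exists (two_round coins_pr_dist uplink0 queries0 answers0 (bb * (1 + c * B) * L)
  (bb * (L * N)) (bb * (L * N)) send (fun=> ask) answer exact_output).
split=> // [x x_bounded|w x]; last exact: two_round_cost.
pose g (S : {set 'I_n}) (w : level_draws n k M c B) j : R :=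
  (j \in candidates N Sm p delta T (msgs q p (fun i => restrict (x i) S) w))%:R
  * freq R (fun i => restrict (x i) S) j `^ p.
have g_err S : Ex (level_draws_pr p)
      (fun w => \sum_j (g S w j - (j \in S)%:R * target x j) ^+ 2)
    <= (beta * \sum_j (j \in S)%:R * target x j) ^+ 2.
  have := Ex_candidates_error p_ge2 p_le_q k_gt0 B_gt0 T_gt0 delta_gt0 delta_le
     (fun i => restrict (x i) S) c_gt0 B_large T_ge1 n_le N_large Sm_large.
  rewrite (restrict_moment x_bounded) => h.
  under eq_Ex do under eq_bigr do rewrite -(restrict_freq x_bounded).
  by apply: le_trans h _; rewrite exprMn ler_wpM2r ?sqr_ge0.
have res (w : coins) : let us := [ffun i => send w i (x i)] in
    exact_output w us [ffun i => answer w i (x i) (ask us)]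
    = subsampled_sum g w.1 w.2.
  move=> us; apply: eq_bigr => l _; congr (_ * _).
  apply: eq_bigr => j _; congr (_ * _); rewrite /g.
  have -> : msgs q p (fun i => restrict (x i) (survivors w.1 l)) (w.2 l)
    = (fun i => us i l) by apply/funext => i; rewrite !ffunE.
  rewrite -/(candidate_set us l).
  case: (boolP (j \in candidate_set us l)) => jc; last by rewrite !mul0r.
  by rewrite collectedE.
rewrite (eq_bigl (fun w : coins => `|subsampled_sum g w.1 w.2 - Fp p (\sum_i x i)|
    <= eps * Fp p (\sum_i x i))); first exact: approximation_pr.
by move=> w; rewrite two_round_result ?card_uplink ?card_queries ?card_answers // -res.
Qed.

End Protocols.

(** * Choice of the parameters and the resulting cost *)

Section Tuning.
Variables (R : realType) (p : R) (q A a : nat).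
Hypotheses (p_ge2 : 2 <= p) (p_le_q : p <= q%:R).

Let K : R := level_const R q.
(** Enough bits for one rounded moment or one draw when [n <= 2 ^ u], because then
    [A * n ^ a <= 2 ^ (A + u * a)]. *)
Let code_bits (u : nat) : nat := (u + (q + 1) * (A + u * a + 1) + 2)%N.
Let code_const : nat := (2 * (1 + (q + 1) * a) + ((q + 1) * (A + 1) + 2))%N.
Let q2 : R := 2 ^+ q + 2.
(** 7 comes from the number of levels, 1569 = 1 + 32 * 49 from the rounded moment and the samples,
    [2 * q2] from queries and answers, and 1568 = 32 * 49 from [T]. *)
Let cost_const : R := 7 * code_const%:R * (1569 + 2 * q2) * (1568 * K).

Lemma level_const_ge1 : 1 <= K.
Proof.
have h1 : 1 <= 64 ^+ q :> R by rewrite exprn_ege1 // ler1n.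
have h2 : 0 <= 2 ^+ q :> R by rewrite exprn_ge0.
by apply: le_trans h1 _; rewrite /K /level_const ler_peMl ?exprn_ge0 //; lra.
Qed.

Lemma nat_between (x : R) : 1 <= x -> exists m : nat,
  [/\ (0 < m)%N, x <= m%:R & m%:R <= x + 1].
Proof.
move=> x1; exists (Num.truncn x).+1; split=> //; first exact/ltW/truncnS_gt.
by rewrite -natr1 lerD2r truncn_le // (le_trans _ x1).
Qed.

Lemma up_log_le_ln (n : nat) : (0 < n)%N -> (up_log 2 n)%:R <= 2 * (1 + ln n%:R) :> R.
Proof.
move=> n0; have n1 : 1 <= n%:R :> R by rewrite ler1n.
have l0 := ln_ge0 n1; have [n_gt1|n_le1] := ltnP 1 n; last first.
  have -> : up_log 2 n = 0%N by apply/eqP; rewrite up_log_eq0 n_le1 orbT.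
  by rewrite mulr_ge0 // addr_ge0.
(* This is ln (1 + x) <= x at x = -1/2. *)
have ln2 : 2^-1 <= ln 2 :> R.
  have := @le_ln1Dx R (- 2^-1); have -> : 1 + - 2^-1 = 2^-1 :> R by lra.
  by rewrite lnV ?posrE // lerN2; apply; lra.
have := up_log_gtn (isT : 1 < 2)%N n_gt1.
have : (0 < up_log 2 n)%N by rewrite up_log_gt0.
case: (up_log 2 n) => // u _ /= lt_n.
have : ln ((2 ^ u)%:R : R) <= ln n%:R.
  by rewrite ler_ln ?posrE ?ltr0n ?expn_gt0 // ler_nat ltnW.
rewrite natrX lnXn // -[ln 2 *+ u]mulr_natr -[u.+1%:R]natr1.
have : 2^-1 * u%:R <= ln 2 * u%:R :> R by rewrite ler_wpM2r.
by lra.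
Qed.

Lemma input_bound_le (n u : nat) : (n <= 2 ^ u)%N ->
  (A * n ^ a <= 2 ^ (A + u * a))%N.
Proof.
move=> nu; rewrite expnD expnM leq_mul ?leq_exp2r_weak //.
by rewrite ltnW // ltn_expl.
Qed.

Lemma pow2_succ_le (x e f : nat) : (x <= 2 ^ e)%N -> (e < f)%N -> (x.+1 <= 2 ^ f)%N.
Proof.
move=> xe ef; apply: (@leq_trans (2 ^ e.+1)); last by rewrite leq_exp2l.
rewrite expnS mul2n -addnn -addn1 leq_add // expn_gt0 //.
Qed.

Lemma code_bits_norm (n u : nat) : (n <= 2 ^ u)%N ->
  ((n * (A * n ^ a) ^ q).+1 <= 2 ^ code_bits u)%N.
Proof.
move=> nu; apply: (@pow2_succ_le _ (u + (A + u * a) * q)).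
  rewrite expnD leq_mul // expnM leq_exp2r_weak // input_bound_le //.
rewrite /code_bits; move: (A + u * a)%N => z; lia.
Qed.

Lemma code_bits_draw (n u : nat) : (n <= 2 ^ u)%N ->
  ((n * (A * n ^ a).+1).+1 <= 2 ^ code_bits u)%N.
Proof.
move=> nu; apply: (@pow2_succ_le _ (u + (A + u * a).+1)).
  rewrite expnD leq_mul // (pow2_succ_le (input_bound_le nu)) //.
rewrite /code_bits; move: (A + u * a)%N => z; nia.
Qed.

(* [E] bounds 1 / delta^p; the three summands are the bits
   that one site exchanges for the samples, the queries and the answers. *)
Lemma cost_arith (kk kp2 bbr Lr cr Br Nr lam T E eps : R) :
  0 <= kk -> 1 <= kp2 -> 1 <= lam -> 1 <= T -> 1 <= E -> 0 < eps ->
  0 <= bbr <= code_const%:R * lam -> 0 <= Lr <= 7 * lam -> 0 <= cr <= 7 * lam ->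
  0 <= Br <= 2 * (kp2 * (16 * cr * T * E)) -> 0 <= Nr <= q2 * T ->
  T <= 1568 * K * lam ^+ 2 / eps ^+ 2 ->
  kk * (bbr * (1 + cr * Br) * Lr + bbr * (Lr * Nr) + bbr * (Lr * Nr))
  <= cost_const * (kk * kp2 / eps ^+ 2) * E * lam ^+ 6.
Proof.
move=> kk0 kp1 l1 T1 E1 eps0 /andP[b0 bU] /andP[L0 LU] /andP[c0 cU]
  /andP[B0 BU] /andP[N0 NU] TU.
have e20 : 0 < eps ^+ 2 by rewrite exprn_gt0.
have q20 : 0 <= q2 by rewrite addr_ge0 ?exprn_ge0.
set W := lam ^+ 2 * kp2 * T * E.
have l2 : 1 <= lam ^+ 2 by rewrite exprn_ege1.
have lk : 1 <= lam ^+ 2 * kp2 by rewrite mulr_ege1.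
have W1 : T <= W.
  have -> : W = T * (lam ^+ 2 * kp2 * E) by rewrite /W; ring.
  by rewrite ler_peMr ?mulr_ege1 // (le_trans _ T1).
have W0 : 0 <= W by apply: le_trans W1; apply: le_trans T1.
have X0 : 0 <= kp2 * T * E.
  by rewrite !mulr_ge0 // ?(le_trans _ kp1) ?(le_trans _ T1) ?(le_trans _ E1).
have cB : cr * Br <= 1568 * W.
  apply: (@le_trans _ _ (32 * cr ^+ 2 * (kp2 * T * E))).
    by apply: le_trans (ler_wpM2l c0 BU) _; apply: ler_of_eq; ring.
  have c2 : cr ^+ 2 <= 49 * lam ^+ 2.
    have -> : 49 * lam ^+ 2 = (7 * lam) ^+ 2 by ring.
    by rewrite lerXn2r ?nnegrE // (le_trans c0).
  have := ler_wpM2r X0 c2; rewrite /W; lra.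
have NW : Nr <= q2 * W by apply: le_trans NU _; rewrite ler_wpM2l.
have bL : bbr * Lr <= 7 * code_const%:R * lam ^+ 2.
  apply: le_trans (ler_pM b0 L0 bU LU) _.
  by apply: ler_of_eq; ring.
have S1 : 1 + cr * Br + 2 * Nr <= (1569 + 2 * q2) * W.
  by rewrite mulrDl; have := le_trans T1 W1; lra.
have S0 : 0 <= 1 + cr * Br + 2 * Nr.
  by rewrite !addr_ge0 ?mulr_ge0.
have -> : kk * (bbr * (1 + cr * Br) * Lr + bbr * (Lr * Nr) + bbr * (Lr * Nr))
  = kk * ((bbr * Lr) * (1 + cr * Br + 2 * Nr)) by ring.
have WU : W <= lam ^+ 2 * kp2 * E * (1568 * K * lam ^+ 2 / eps ^+ 2).
  have -> : W = lam ^+ 2 * kp2 * E * T by rewrite /W; ring.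
  by rewrite ler_wpM2l // mulr_ge0 ?(le_trans _ lk) ?(le_trans _ E1).
have -> : cost_const * (kk * kp2 / eps ^+ 2) * E * lam ^+ 6
  = kk * ((7 * code_const%:R * lam ^+ 2) * ((1569 + 2 * q2) *
     (lam ^+ 2 * kp2 * E * (1568 * K * lam ^+ 2 / eps ^+ 2)))).
  by rewrite /cost_const; field; rewrite gt_eqF.
have c1 : 0 <= 1569 + 2 * q2 by lra.
apply: (ler_wpM2l kk0); apply: (ler_pM (mulr_ge0 b0 L0) S0 bL).
exact: le_trans S1 (ler_wpM2l c1 WU).
Qed.

Section Choice.
Variables (n k : nat) (eps delta E : R).
Hypotheses (n_gt0 : (0 < n)%N) (k_gt0 : (0 < k)%N) (eps01 : 0 < eps < 1).
Hypotheses (delta_gt0 : 0 < delta) (delta_le : delta <= 2^-1)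
  (E_ge1 : 1 <= E) (delta_E : (delta `^ p)^-1 <= E).

Let u : nat := up_log 2 n.
(** Five levels beyond the logarithm make the last level nonempty with probability at most 1/32.
    With [beta] below, the Markov term is 1/4, and the sum stays under 1/3. *)
Let L : nat := u + 5.
(** Solves [K / T = beta ^+ 2 / 2]; the other half of the budget is left for [K * delta ^+ 2] in one
    round. *)
Let T : R := 32 * K * L%:R ^+ 2 / eps ^+ 2.
Let beta : R := eps / (4 * L%:R).
Let M : nat := (A * n ^ a)%N.
Let budget : R :=
  cost_const * (k%:R `^ (p - 1) / eps ^+ 2) * E * (1 + ln n%:R) ^+ 6.

Let eps_gt0 : 0 < eps. Proof. by case/andP: eps01. Qed.
Let eps_lt1 : eps < 1. Proof. by case/andP: eps01. Qed.
Let L_gt0 : 0 < L%:R :> R. Proof. by rewrite ltr0n addn_gt0 orbT. Qed.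
Let K_gt0 : 0 < K. Proof. exact: lt_le_trans level_const_ge1. Qed.

Lemma sample_rate_ge1 : 1 <= T.
Proof.
rewrite /T ler_pdivlMr ?exprn_gt0 // mul1r.
apply: (@le_trans _ _ 1); first by rewrite exprn_ile1 // ltW.
rewrite -[X in X <= _]mulr1; apply: ler_pM => //; last first.
  by rewrite exprn_ege1 // ler1n addn_gt0 orbT.
by have := level_const_ge1; lra.
Qed.

Lemma levels_le : L%:R <= 7 * (1 + ln n%:R) :> R.
Proof.
have -> : L%:R = u%:R + 5 :> R by rewrite /L natrD.
have l1 : 1 <= 1 + ln n%:R :> R by rewrite lerDl ln_ge0 // ler1n.
by have := up_log_le_ln n_gt0; rewrite -/u; lra.
Qed.

Lemma rate_le : T <= 1568 * K * (1 + ln n%:R) ^+ 2 / eps ^+ 2.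
Proof.
apply: ler_wpM2r; first by rewrite invr_ge0 sqr_ge0.
have LL : L%:R ^+ 2 <= (7 * (1 + ln n%:R)) ^+ 2 :> R.
  rewrite lerXn2r ?nnegrE ?(ltW L_gt0) ?levels_le //.
  exact: le_trans (ltW L_gt0) levels_le.
have K32 : 0 <= 32 * K by rewrite mulr_ge0 // ltW.
by have := ler_wpM2l K32 LL; lra.
Qed.

Lemma beta_sqr : beta ^+ 2 = eps ^+ 2 / (16 * L%:R ^+ 2).
Proof. by rewrite /beta; field; rewrite gt_eqF. Qed.

Lemma rate_error : K / T = beta ^+ 2 / 2.
Proof. by rewrite beta_sqr /T; field; rewrite !gt_eqF. Qed.

Lemma failure_pr_le : 2 / 3 <= 1 - n%:R * 2^-1 ^+ L - L%:R * beta / eps :> R.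
Proof.
have -> : L%:R * beta / eps = 4^-1 :> R by rewrite /beta; field; rewrite !gt_eqF.
have : n%:R * 2^-1 ^+ L <= 2^-1 ^+ 5 :> R.
  rewrite /L exprD mulrA ler_piMl ?exprn_ge0 // exprVn ler_pdivrMr ?exprn_gt0 //.
  by rewrite mul1r -natrX ler_nat up_logP.
by lra.
Qed.

Lemma protocol_parameters : exists B N Sm : nat,
  [/\ (0 < B)%N,
      k%:R `^ (p - 2) * (16 * (u + 3)%:R * T / delta `^ p) <= B%:R,
      (2 ^+ q + 1) * T <= N%:R,
      N%:R <= (2 ^+ q + 2) * T
    & k%:R * M%:R <= tau T Sm]
  /\ (k * (code_bits u * (1 + (u + 3) * B) * L + code_bits u * (L * N)
       + code_bits u * (L * N)))%N%:R <= budget.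
Proof.
have T1 := sample_rate_ge1.
have T0 : 0 < T by apply: lt_le_trans T1.
set kp2 := k%:R `^ (p - 2).
have kp1 : 1 <= kp2.
  apply: (@le_trans _ _ (1 `^ (p - 2))); first by rewrite powR1.
  by apply: ler_powR_base; rewrite ?subr_ge0 ?ler1n.
have dp0 : 0 < delta `^ p by rewrite powR_gt0.
have dp1 : 1 <= (delta `^ p)^-1.
  rewrite invf_ge1 //; apply: (@le_trans _ _ (1 `^ p)); last by rewrite powR1.
  apply: ler_powR_base; [exact: le_trans p_ge2|exact: ltW|].
  by apply: le_trans delta_le _; rewrite invf_le1 ?ler1n.
set cr : R := (u + 3)%:R; have cr1 : 1 <= cr by rewrite ler1n addn_gt0 orbT.
(* A target of at least 1 is at most doubled when rounded up to [B]. *)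
have X1 : 1 <= kp2 * (16 * cr * T / delta `^ p).
  rewrite mulr_ege1 // mulr_ege1 // mulr_ege1 // mulr_ege1 //; lra.
have [B [B0 BL BU]] := nat_between X1.
have Y1 : 1 <= (2 ^+ q + 1) * T.
  by rewrite mulr_ege1 // lerDr exprn_ge0.
have [N [N0 NL NU]] := nat_between Y1.
(* A crude [Sm] suffices, through [Sm <= 2 ^ Sm]: the number of scales does not enter the cost. *)
have Z1 : 1 <= k%:R * M%:R * T + 1.
  by rewrite lerDr mulr_ge0 // ltW.
have [Sm [_ SmL _]] := nat_between Z1.
exists B, N, Sm; split.
  split=> //; first by apply: le_trans NU _; rewrite !mulrDl; lra.
  rewrite /tau ler_pdivlMr //.
  have : Sm%:R <= 2 ^+ Sm :> R by rewrite -natrX ler_nat ltnW // ltn_expl.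
  by lra.
have l1 : 1 <= 1 + ln n%:R :> R by rewrite lerDl ln_ge0 // ler1n.
have u_le := up_log_le_ln n_gt0; rewrite -/u in u_le.
have kk : k%:R `^ (p - 1) = k%:R * kp2.
  have p1 : 0 < p - 1 by have p2 := p_ge2; lra.
  by rewrite /kp2 -(mulr_powRB1 (ler0n R k) p1); congr (_ * _ `^ _); ring.
rewrite /budget kk; set c := (u + 3)%N in cr cr1 BL BU X1 *.
have -> : (k * (code_bits u * (1 + c * B) * L + code_bits u * (L * N)
     + code_bits u * (L * N)))%N%:R
  = k%:R * ((code_bits u)%:R * (1 + c%:R * B%:R) * L%:R
     + (code_bits u)%:R * (L%:R * N%:R) + (code_bits u)%:R * (L%:R * N%:R)) :> R.
  by rewrite !(natrM, natrD).
have code_le : (code_bits u)%:R <= code_const%:R * (1 + ln n%:R) :> R.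
  have -> : code_bits u = (u * (1 + (q + 1) * a) + ((q + 1) * (A + 1) + 2))%N.
    by rewrite /code_bits; ring.
  rewrite /code_const; move: ((1 + (q + 1) * a)%N) (((q + 1) * (A + 1))%N) => e f.
  rewrite !(natrD, natrM); have := ler_wpM2r (ler0n R e) u_le.
  have := ler_wpM2l (ler0n R f) l1.
  by lra.
have c_le : c%:R <= 7 * (1 + ln n%:R) :> R.
  have -> : c%:R = u%:R + 3 :> R by rewrite /c natrD.
  by lra.
have L_le : L%:R <= 7 * (1 + ln n%:R) :> R.
  exact: levels_le.
apply: (@cost_arith k%:R kp2 (code_bits u)%:R L%:R c%:R B%:R N%:R (1 + ln n%:R) T E eps);
  rewrite ?ler0n //=.
- apply: le_trans BU _; have XE : kp2 * (16 * cr * T / delta `^ p)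
      <= kp2 * (16 * cr * T * E).
    rewrite ler_wpM2l ?(le_trans _ kp1) // ler_wpM2l // mulr_ge0 ?(ltW T0) //.
    by rewrite mulr_ge0.
  apply: le_trans (lerD (lexx _) X1) _; rewrite -[leLHS]mulr2n -[leLHS]mulr_natl.
  exact: ler_wpM2l XE.
- apply: le_trans NU _; rewrite /q2.
  by have -> : (2 ^+ q + 2) * T = (2 ^+ q + 1) * T + T; [ring | rewrite lerD2l].
- exact: rate_le.
Qed.

Lemma beta_ge0 : 0 <= beta.
Proof. by rewrite divr_ge0 ?mulr_ge0 // ltW. Qed.

Lemma n_le_up_log : (n <= 2 ^ u)%N.
Proof. exact: up_logP. Qed.

Lemma n_le_copies : (n <= 2 ^ (u + 3 - 3))%N.
Proof. by rewrite addnK n_le_up_log. Qed.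

Lemma one_round_bound : K * delta ^+ 2 <= beta ^+ 2 / 2 ->
  exists P : protocol R k 'rV[nat]_n,
    [/\ rounds P = 1%N, approximates_Fp P M p eps & uses_at_most P M budget].
Proof.
move=> d_small; have [B [N [Sm [[B0 BL NL NU SmL] cost]]]] := protocol_parameters.
have err : K * (T^-1 + delta ^+ 2) <= beta ^+ 2.
  by rewrite mulrDr rate_error; lra.
have [P [rP aP cP]] := one_round_exists p_ge2 p_le_q k_gt0 B0 sample_rate_ge1
  delta_gt0 delta_le (leq_addl u 3) n_le_copies BL NL NU SmL eps_gt0 beta_ge0
  failure_pr_le (code_bits_norm n_le_up_log) (code_bits_draw n_le_up_log) err.
exists P; split=> // x xb w; rewrite cP; apply: le_trans cost.
by rewrite ler_nat leq_mul2l -addnA leq_addr orbT.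
Qed.

Lemma two_round_bound :
  exists P : protocol R k 'rV[nat]_n,
    [/\ rounds P = 2%N, approximates_Fp P M p eps & uses_at_most P M budget].
Proof.
have [B [N [Sm [[B0 BL NL NU SmL] cost]]]] := protocol_parameters.
have err : K / T <= beta ^+ 2 by rewrite rate_error; have := sqr_ge0 beta; lra.
have [P [rP aP cP]] := two_round_exists p_ge2 p_le_q k_gt0 B0 sample_rate_ge1
  delta_gt0 delta_le (leq_addl u 3) n_le_copies BL NL SmL eps_gt0 beta_ge0
  failure_pr_le (code_bits_norm n_le_up_log) (code_bits_draw n_le_up_log) n_gt0 err.
by exists P; split=> // x xb w; rewrite cP.
Qed.

End Choice.

Lemma uses_at_most_le n k (P : protocol R k 'rV[nat]_n) M (b b' : R) :
  b <= b' -> uses_at_most P M b -> uses_at_most P M b'.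
Proof. by move=> bb' Pb x xb w; apply: le_trans bb'; exact: Pb. Qed.

Lemma two_round_protocols : exists (C : R) (c : nat),
  forall (n k : nat) (eps : R), (0 < n)%N -> (0 < k)%N -> 0 < eps < 1 ->
    exists P : protocol R k 'rV[nat]_n,
      [/\ rounds P = 2%N,
          approximates_Fp P (A * n ^ a)%N p eps
        & uses_at_most P (A * n ^ a)%N
            (C * (k%:R `^ (p - 1) / eps ^+ 2) * (1 + ln n%:R) ^+ c)].
Proof.
(* Here [delta] is 1/2, so [2 ^+ q] bounds the factor [E]. *)
exists (cost_const * 2 ^+ q), 6%N => n k eps n0 k0 eps01.
have h0 : 0 < 2^-1 :> R by rewrite invr_gt0.
have E1 : 1 <= 2 ^+ q :> R by rewrite exprn_ege1 // ler1n.
have hE : ((2^-1 : R) `^ p)^-1 <= 2 ^+ q.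
  by rewrite powR_inv // invrK powR_le_exprn ?ler1n.
have [P [rP aP cP]] := two_round_bound n0 k0 eps01 h0 (lexx _) E1 hE.
exists P; split=> //; apply: uses_at_most_le cP.
by rewrite [X in _ <= X * _]mulrAC.
Qed.

Lemma one_round_protocols : exists (C : R) (c : nat),
  forall (n k : nat) (eps : R), (0 < n)%N -> (0 < k)%N -> 0 < eps < 1 ->
    exists P : protocol R k 'rV[nat]_n,
      [/\ rounds P = 1%N,
          approximates_Fp P (A * n ^ a)%N p eps
        & uses_at_most P (A * n ^ a)%N
            (C * (k%:R `^ (p - 1) / eps `^ (p + 2)) * (1 + ln n%:R) ^+ c)].
Proof.
exists (cost_const * (56 * K) ^+ q), (6 + q)%N => n k eps n0 k0 eps01.
have /andP[eps0 eps1] := eps01; have K1 := level_const_ge1.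
pose L : R := (up_log 2 n + 5)%:R; pose lam : R := 1 + ln n%:R.
have L1 : 1 <= L by rewrite ler1n addn_gt0 orbT.
have LU : L <= 7 * lam by exact: levels_le.
have KL : 1 <= K * L by rewrite mulr_ege1.
have x8 : 8 <= 8 * (K * L) by rewrite ler_peMr.
have KLU : 8 * (K * L) <= 56 * K * lam.
  by have := ler_wpM2l (le_trans ler01 K1) LU; lra.
(* Since [1 <= K], this gives [K * delta ^+ 2] at most half of beta squared. Its inverse power p
   yields the extra power of 1 / eps and, bounded with exponent [q], the extra [q] logarithmic
   factors. *)
pose delta := eps / (8 * (K * L)).
have d0 : 0 < delta by rewrite divr_gt0 //; lra.
have d1 : delta <= 2^-1 by rewrite ler_pdivrMr; lra.
have ep0 : 0 < eps `^ p by rewrite powR_gt0.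
have ep1 : eps `^ p <= 1.
  apply: (@le_trans _ _ (1 `^ p)); last by rewrite powR1.
  by apply: ler_powR_base; [exact: le_trans p_ge2|exact: ltW|exact: ltW].
pose E := (56 * K * lam) ^+ q / eps `^ p.
have E0 : 1 <= (56 * K * lam) ^+ q by rewrite exprn_ege1 //; lra.
have E1 : 1 <= E by rewrite ler_pdivlMr // mul1r (le_trans ep1).
have hE : (delta `^ p)^-1 <= E.
  have -> : (delta `^ p)^-1 = (8 * (K * L)) `^ p / eps `^ p.
    have K8 : 0 <= 8 * (K * L) by lra.
    by rewrite /delta powRM ?invr_ge0 ?(ltW eps0) // powR_inv // invf_div.
  apply: ler_wpM2r; first by rewrite invr_ge0 ltW.
  apply: le_trans (powR_le_exprn _ p_le_q) _; first by lra.
  by rewrite lerXn2r ?nnegrE //; lra.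
have hd : K * delta ^+ 2 <= (eps / (4 * L)) ^+ 2 / 2.
  have -> : K * delta ^+ 2 = (eps / (4 * L)) ^+ 2 / 4 / K.
    by rewrite /delta; field; rewrite !gt_eqF //; lra.
  rewrite ler_pdivrMr; last by lra.
  have := sqr_ge0 (eps / (4 * L)); set z := _ ^+ 2 => z0.
  have : z / 2 <= z / 2 * K by rewrite ler_peMr // divr_ge0.
  by lra.
have [P [rP aP cP]] := one_round_bound n0 k0 eps01 d0 d1 E1 hE hd.
exists P; split=> //; apply: uses_at_most_le cP.
apply: ler_of_eq.
have -> : eps `^ (p + 2) = eps `^ p * eps ^+ 2.
  by rewrite powRD ?(gt_eqF eps0) ?implybT // (powR_mulrn 2 (ltW eps0)).
rewrite /E exprD (exprMn_comm _ (mulrC _ _)) -/lam.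
by field; rewrite !gt_eqF.
Qed.

End Tuning.

Theorem theorem7 (R : realType) (p : R) (A a : nat) (hp : 2 <= p) :
  (exists (C : R) (c : nat),
     forall (n k : nat) (eps : R), (0 < n)%N -> (0 < k)%N -> 0 < eps < 1 ->
       exists P : protocol R k 'rV[nat]_n,
         [/\ rounds P = 2%N,
             approximates_Fp P (A * n ^ a)%N p eps
           & uses_at_most P (A * n ^ a)%N
               (C * (k%:R `^ (p - 1) / eps ^+ 2) * (1 + ln n%:R) ^+ c)])
  /\
  (exists (C : R) (c : nat),
     forall (n k : nat) (eps : R), (0 < n)%N -> (0 < k)%N -> 0 < eps < 1 ->
       exists P : protocol R k 'rV[nat]_n,
         [/\ rounds P = 1%N,
             approximates_Fp P (A * n ^ a)%N p eps
           & uses_at_most P (A * n ^ a)%N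
               (C * (k%:R `^ (p - 1) / eps `^ (p + 2)) * (1 + ln n%:R) ^+ c)]).
Proof.
(* The integer [q] depends on [p] only, so the powers with exponent [q] are constants. *)
have p_le : p <= (Num.truncn p).+1%:R by exact/ltW/truncnS_gt.
by split; [exact: two_round_protocols hp p_le|exact: one_round_protocols hp p_le].
Qed.
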